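(* Fix integers $n\ge 2$, $d\ge 3$ and assume $(n,d)\ne(2,3)$. Let $C\subset\mathbb{P}^n$ be a rational normal curve and let $S\subset C$ be a collection of $x$ (distinct) points on the curve. Then (i) if $n\ge 3$, $d\ge 4$ and $x\ge 1+\lceil nd/2\rceil$, then $S\in\mathbb{T}(n,d;x)$; (ii) if $n\ge 4$, $d=3$ and $x=1+\lceil nd/2\rceil$, then $S\in\mathbb{T}(n,d;x)$; (iii) if $n\ge 2$, $d\ge 4$ and $x=1+\lceil nd/2\rceil$, then $S\in\mathbb{T}(n,d;x)'$.
   Context: We work over an algebraically closed field of characteristic $0$. For a finite set $S\subset\mathbb{P}^n$, $\langle S\rangle$ is its linear span, and $2S\subset\mathbb{P}^n$ is the zero-dimensional scheme defined by the ideal sheaf $(\mathcal{I}_S)^2$ (the union of the double points supported at $S$). For a closed subscheme $Z\subset\mathbb{P}^n$, $h^i(\mathcal{I}_Z(d))=\dim H^i(\mathbb{P}^n,\mathcal{I}_Z(d))$. $\mathbb{T}(n,d;x)$ is the set of all subsets $S\subset\mathbb{P}^n$ of cardinality $x$ such that $h^0(\mathcal{I}_{2S}(d))>0$, $h^1(\mathcal{I}_{2S}(d))>0$ and $\langle S\rangle=\mathbb{P}^n$. $\mathbb{T}(n,d;x)'$ (the minimally Terracini sets) is the set of all $S\in\mathbb{T}(n,d;x)$ such that $h^1(\mathcal{I}_{2A}(d))=0$ for all $A\subsetneq S$. A rational normal curve of $\mathbb{P}^n$ is irreducible (a smooth rational curve of degree $n$ spanning $\mathbb{P}^n$). *)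

(* Defs.v *)
From HB Require Import structures.
From mathcomp Require Import all_boot all_order all_algebra.
From mathcomp Require Import fraction.
From mathcomp Require Import finmap.
From mathcomp Require Import mpoly.

Set Implicit Arguments.
Unset Strict Implicit.
Unset Printing Implicit Defensive.

Import GRing.Theory.
Local Open Scope ring_scope.
Local Open Scope fset_scope.

(* Points of P^n are the lines of K^(n+1); Leibniz equality on {vspace _} is
   equality of subspaces. *)
Definition Pn (K : fieldType) (n : nat) : Type :=
  {U : {vspace 'rV[K]_n.+1} | \dim U == 1%N}.

Section Cohomology.

Variables (K : fieldType) (n : nat).

Local Notation R := {mpoly K[n.+1]}.
Local Notation F := {fraction {mpoly K[n.+1]}}.

Definition mevalv (m : nat) (f : {mpoly K[m]}) (v : 'rV[K]_m) : K :=
  f.@[fun i => v 0 i].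

Definition vanishing_ideal (S : {fset Pn K n}) (f : R) : Prop :=
  forall p : Pn K n, p \in S ->
  forall v : 'rV[K]_n.+1, v \in val p -> mevalv f v = 0.

Definition ideal_square (I : R -> Prop) (f : R) : Prop :=
  exists s : seq (R * R),
    (forall q, q \in s -> I q.1 /\ I q.2) /\ f = \sum_(q <- s) q.1 * q.2.

(* The homogeneous ideal whose associated sheaf is the square of the ideal
   sheaf of S, that is, the ideal sheaf of the scheme 2S. It need not be
   saturated; only the sheaf it defines is used. *)
Definition double_ideal (S : {fset Pn K n}) : R -> Prop :=
  ideal_square (vanishing_ideal S).

(* Sections over D_+(f), with f a form of degree e, of the d-th twist of the
   sheaf associated with a homogeneous ideal I: the degree d part of the
   localization I_f, inside the fraction field of R (as R is a domain,
   restriction maps are then inclusions). *)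
Definition sections (I : R -> Prop) (d e : nat) (f : R) (phi : F) : Prop :=
  exists (k : nat) (g : R),
    [/\ I g, g \is (d + k * e)%N.-homog & phi = tofrac g / tofrac f ^+ k].

(* Cech p-cochains for the cover of P^n by the open sets D_+('X_i), with
   values indexed by all (p+1)-tuples of indices (not only increasing ones). *)
Definition cochain (p : nat) : Type := {ffun 'I_p.+1 -> 'I_n.+1} -> F.

Definition is_cochain (I : R -> Prop) (d p : nat) (c : cochain p) : Prop :=
  forall s : {ffun 'I_p.+1 -> 'I_n.+1},
    sections I d p.+1 (\prod_(j < p.+1) 'X_(s j)) (c s).

Definition cech_diff (p : nat) (c : cochain p) : cochain p.+1 :=
  fun s => \sum_(j < p.+2) (-1) ^+ j * c [ffun k => s (lift j k)].

Definition cocycle (I : R -> Prop) (d p : nat) (c : cochain p) : Prop :=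
  is_cochain I d c /\ forall s, cech_diff c s = 0.

Definition coboundary (I : R -> Prop) (d p : nat) : cochain p -> Prop :=
  match p return cochain p -> Prop with
  | 0 => fun c => forall s, c s = 0
  | q.+1 => fun c => exists b : cochain q,
      is_cochain I d b /\ forall s, c s = cech_diff b s
  end.

(* dim_K H^p(P^n, I~(d)) >= m: there are m cocycles that are linearly
   independent modulo coboundaries. *)
Definition coh_dim_ge (I : R -> Prop) (d p m : nat) : Prop :=
  exists c : 'I_m -> cochain p,
    (forall j, cocycle I d (c j)) /\
    (forall a : 'I_m -> K,
       coboundary I d (fun s => \sum_(j < m) tofrac (a j)%:MP * c j s) ->
       forall j, a j = 0).

Definition h_pos (p : nat) (S : {fset Pn K n}) (d : nat) : Prop :=
  coh_dim_ge (double_ideal S) d p 1.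

Definition h_zero (p : nat) (S : {fset Pn K n}) (d : nat) : Prop :=
  ~ coh_dim_ge (double_ideal S) d p 1.

Definition spans (S : {fset Pn K n}) : Prop :=
  (\sum_(p <- S) val p)%VS = fullv.

Definition terracini (d x : nat) (S : {fset Pn K n}) : Prop :=
  [/\ #|` S| = x, h_pos 0 S d, h_pos 1 S d & spans S].

Definition min_terracini (d x : nat) (S : {fset Pn K n}) : Prop :=
  terracini d x S /\ forall A : {fset Pn K n}, A `<` S -> h_zero 1 A d.

Definition param_pt (phi : 'I_n.+1 -> {mpoly K[2]}) (u : 'rV[K]_2) :
  'rV[K]_n.+1 := \row_i mevalv (phi i) u.

Definition param_jacobian (phi : 'I_n.+1 -> {mpoly K[2]}) (u : 'rV[K]_2) :
  'M[K]_(n.+1, 2) := \matrix_(i, j) mevalv ((phi i)^`M(j)) u.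

(* A smooth rational curve of degree n is the image of a closed embedding of
   P^1 pulling O(1) back to O(n): it is given by n+1 binary forms of degree n
   without common zero, injectively and with injective differential. In
   characteristic 0 the latter means, by Euler's relation, that the Jacobian
   matrix of the map of affine cones has rank 2. *)
Definition rational_normal_curve (C : Pn K n -> Prop) : Prop :=
  exists phi : 'I_n.+1 -> {mpoly K[2]},
    [/\ forall i, phi i \is n.-homog,
        forall u, u != 0 -> param_pt phi u != 0,
        forall u v, u != 0 -> v != 0 ->
          <[param_pt phi u]>%VS = <[param_pt phi v]>%VS ->
          <[u]>%VS = <[v]>%VS,
        forall u, u != 0 -> \rank (param_jacobian phi u) = 2%N &
        (forall p : Pn K n,
           C p <-> exists2 u, u != 0 & val p = <[param_pt phi u]>%VS) /\
        (forall U : {vspace 'rV[K]_n.+1},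
           (forall p, C p -> (val p <= U)%VS) -> U = fullv)].

End Cohomology.

(* Main.v *)
Require Import Defs.
From HB Require Import structures.
From mathcomp Require Import all_boot all_order all_algebra.
From mathcomp Require Import fraction.
From mathcomp Require Import finmap.
From mathcomp Require Import mpoly.
From mathcomp Require Import ring zify.

Set Implicit Arguments.
Unset Strict Implicit.
Unset Printing Implicit Defensive.

Import GRing.Theory.
Local Open Scope ring_scope.

(** Restricting a form of degree [d] to a rational normal curve [C] of degree
    [n] gives a binary form of degree [n * d], and a point of [2S] on [C] cuts
    out a double point of the line.  As soon as twice the number of points of
    [S] exceeds [n * d + 1], the double points already impose dependent
    conditions on binary forms, so the first cohomology of the ideal sheaf of
    [2S] cannot vanish ([h_pos1_many_points]).  A nonzero section exists for a
    different reason: the square of a quadric through [C], times a form of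
    degree [d - 4], is singular along [C] ([h_pos0_quadric]); for cubics one
    takes a Hankel determinant, which vanishes on the secant variety of [C]
    ([h_pos0_cubic]).  More than [n] points of [C] span the space
    ([curve_points_span], a Vandermonde argument).

    Minimality says that a proper subset [A] of [S] imposes independent double
    point conditions on forms of degree [d].  Everything is done with products
    of hyperplanes: a hyperplane is a binary form of degree [n] on [C], so it
    can be made to contain any [n] points of [C], and [d] hyperplanes have
    [n * d] places in which to put every point other than a chosen [p] twice.
    At least one place is left over, which allows any prescribed first order
    behaviour at [p] ([prescribed_jet]).

    The cohomology groups are Cech groups of the sheaf of the ideal [I_S ^ 2],
    and two facts link them to jets at the points.  Locally on the projective
    space, a form singular at all points of [S] lies in [I_S ^ 2]
    ([double_ideal_local]), and the structure sheaf has no first cohomology in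
    the degrees at hand ([H1_structure_sheaf]).  Hence a 1-cocycle is the
    coboundary of local sections of the structure sheaf, whose jets at [S]
    glue; it is trivial when these jets are those of a global form
    ([h_zero1_of_jets]).  Conversely, jets that no form of degree [d] induces,
    written as a fraction [G / y ^ e] with [y] nowhere zero on [S], give a
    nontrivial 1-cocycle.

    All computations on the curve use an affine parameter: since [S] is finite,
    the parametrization by binary forms becomes one by [n + 1] independent
    polynomials of degree at most [n], with no point of [S] at infinity
    ([curve_parametrization]).  The polynomial 1 is then the restriction of a
    linear form equal to 1 at all chosen representatives of the points of [S],
    which serves as a common denominator. *)

(** * Forms singular at a point *)
Section DoubleVanishing.
Variables (K : fieldType) (N : nat).
Implicit Types (v w : 'rV[K]_N) (f g : {mpoly K[N]}).

(** The first order jet of [f] at [v] is zero.  The value is a separate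
    condition because [f] need not be homogeneous. *)
Definition dvan v f :=
  mevalv f v = 0 /\ forall j, mevalv f^`M(j) v = 0.

Lemma mevalvD v : {morph (fun f => mevalv f v) : f g / f + g}.
Proof. exact: mevalD. Qed.
Lemma mevalvB v : {morph (fun f => mevalv f v) : f g / f - g}.
Proof. exact: mevalB. Qed.
Lemma mevalvM v : {morph (fun f => mevalv f v) : f g / f * g}.
Proof. exact: mevalM. Qed.
Lemma mevalvZ v c f : mevalv (c *: f) v = c * mevalv f v.
Proof. exact: mevalZ. Qed.
Lemma mevalvX v i : mevalv 'X_i v = v 0 i.
Proof. exact: mevalXU. Qed.
Lemma mevalv_exp v f k : mevalv (f ^+ k) v = mevalv f v ^+ k.
Proof. exact: rmorphXn. Qed.
Lemma mevalv_sum v (I : Type) (r : seq I) (P : pred I) (F : I -> {mpoly K[N]}) :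
  mevalv (\sum_(i <- r | P i) F i) v = \sum_(i <- r | P i) mevalv (F i) v.
Proof. exact: rmorph_sum. Qed.
Lemma mevalv_prod v (I : Type) (r : seq I) (P : pred I) (F : I -> {mpoly K[N]}) :
  mevalv (\prod_(i <- r | P i) F i) v = \prod_(i <- r | P i) mevalv (F i) v.
Proof. exact: rmorph_prod. Qed.

Lemma dvan0 v : dvan v 0.
Proof. by split=> [|j]; rewrite /mevalv ?mderiv0 meval0. Qed.

Lemma dvanD v f g : dvan v f -> dvan v g -> dvan v (f + g).
Proof.
move=> [f0 f1] [g0 g1]; split=> [|j]; first by rewrite mevalvD f0 g0 addr0.
by rewrite mderivD mevalvD f1 g1 addr0.
Qed.

Lemma dvanMl v g f : dvan v f -> dvan v (g * f).
Proof.
move=> [f0 f1]; split=> [|j]; first by rewrite mevalvM f0 mulr0.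
by rewrite mderivM mevalvD !mevalvM f0 f1 !mulr0 addr0.
Qed.

Lemma dvanMr v g f : dvan v f -> dvan v (f * g).
Proof. by rewrite mulrC; exact: dvanMl. Qed.

Lemma dvanZ v c f : dvan v f -> dvan v (c *: f).
Proof. by rewrite -mul_mpolyC; exact: dvanMl. Qed.

Lemma dvanN v f : dvan v f -> dvan v (- f).
Proof. by rewrite -scaleN1r; exact: dvanZ. Qed.

Lemma dvanB v f g : dvan v f -> dvan v g -> dvan v (f - g).
Proof. by move=> vf vg; apply/dvanD/dvanN. Qed.

Lemma dvan_sum v (I : eqType) (r : seq I) (F : I -> {mpoly K[N]}) :
  (forall i, i \in r -> dvan v (F i)) -> dvan v (\sum_(i <- r) F i).
Proof.
move=> vF; rewrite big_seq; apply: (big_ind (dvan v)) => //.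
  exact: dvan0.
exact: dvanD.
Qed.

Lemma dvan_mul v f g : mevalv f v = 0 -> mevalv g v = 0 -> dvan v (f * g).
Proof.
move=> f0 g0; split=> [|j]; first by rewrite mevalvM f0 mul0r.
by rewrite mderivM mevalvD !mevalvM f0 g0 mulr0 mul0r addr0.
Qed.

Lemma dvan_cancel v g f : mevalv g v != 0 -> dvan v (g * f) -> dvan v f.
Proof.
move=> g0 [gf0 gf1].
have f0 : mevalv f v = 0.
  by move/eqP: gf0; rewrite mevalvM mulf_eq0 (negPf g0) => /eqP.
split=> // j; move/eqP: (gf1 j).
by rewrite mderivM mevalvD !mevalvM f0 mulr0 add0r mulf_eq0 (negPf g0) => /eqP.
Qed.

Lemma homog_mevalvZ D f c v : f \is D.-homog ->
  mevalv f (c *: v) = c ^+ D * mevalv f v.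
Proof.
move=> /dhomogP hf; rewrite /mevalv !mevalE mulr_sumr.
rewrite big_seq [RHS]big_seq; apply: eq_bigr => m /hf /= mD.
rewrite mulrCA; congr (_ * _).
under eq_bigr do rewrite mxE exprMn.
by rewrite big_split /= prodrXr -mD mdegE.
Qed.

End DoubleVanishing.

(** * Taylor expansion of forms *)

(** Along a linear form [y] with [y v = 1], each variable is a multiple of [y]
    plus a linear form vanishing at [v]; substituting this in a form expands it
    in powers of these linear forms with [y] as the homogenizing variable. *)
Section Taylor.
Variables (K : fieldType) (N : nat) (v : 'rV[K]_N) (y : {mpoly K[N]}).
Hypotheses (hy : y \is 1.-homog) (yv : mevalv y v = 1).
Implicit Types (f g : {mpoly K[N]}).

Definition shift_var (j : 'I_N) : {mpoly K[N]} := 'X_j - v 0 j *: y.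

Lemma homogX1 (j : 'I_N) : ('X_j : {mpoly K[N]}) \is 1.-homog.
Proof. by rewrite dhomogX /= mdeg1. Qed.

Lemma shift_var_homog j : shift_var j \is 1.-homog.
Proof. by apply: rpredB; [exact: homogX1 | apply: dhomogZ]. Qed.

Lemma shift_var_eval j : mevalv (shift_var j) v = 0.
Proof. by rewrite mevalvB mevalvX mevalvZ yv mulr1 subrr. Qed.

Lemma linear_form_exp D : y ^+ D \is D.-homog.
Proof. by have := dhomogMn D hy; rewrite mul1n. Qed.

Lemma taylor1_monomial D m : mdeg m = D.+1 -> exists g : 'I_N -> {mpoly K[N]},
  (forall j, g j \is D.-homog) /\
  'X_[m] = mevalv 'X_[m] v *: y ^+ D.+1 + \sum_j shift_var j * g j.
Proof.
elim: D m => [|D IH] m mD.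
  have /eqP := mD; rewrite mdeg_eq1 => /existsP[j /eqP ->].
  exists (fun i => (i == j)%:R); split=> [i|].
    by case: eqP => _; [exact: dhomog1 | exact: rpred0].
  rewrite mevalvX expr1 (bigD1 j) //= eqxx mulr1 big1 ?addr0 => [|i /negPf ->].
    by rewrite /shift_var addrC subrK.
  by rewrite mulr0.
have [j mj] : exists j, (0 < m j)%N.
  apply/existsP; apply: contraTT (ltn0Sn D) => /existsPn m0.
  suff : mdeg m = 0%N by rewrite mD.
  by rewrite mdegE big1 // => i _; have := m0 i; lia.
have [k Em] : exists k, m = (U_(j) + k)%MM.
  exists (m - U_(j))%MM; apply/mnmP=> i; rewrite mnmDE mnmBE mnm1E.
  by case: eqVneq => [<-|_]; lia.
have dm : mdeg k = D.+1.
  by move: mD; rewrite Em mdegD mdeg1 => -[].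
have [g [gh Eg]] := IH _ dm.
exists (fun i => (if i == j then mevalv 'X_[k] v *: y ^+ D.+1 else 0)
                  + 'X_j * g i); split=> [i|].
  rewrite /=; apply: rpredD.
    by case: ifP => _; [apply/dhomogZ/linear_form_exp | exact: rpred0].
  by have := dhomogM (homogX1 j) (gh i); rewrite add1n.
rewrite Em mpolyXD mevalvM mevalvX.
under eq_bigr do rewrite mulrDr.
rewrite big_split /= (bigD1 j) //= eqxx [X in _ + (_ + X + _)]big1 ?addr0; last first.
  by move=> i /negPf ->; rewrite mulr0.
rewrite {1}Eg.
under [X in _ = _ + (_ + X)]eq_bigr do rewrite mulrCA.
rewrite -mulr_sumr mulrDr addrA; congr (_ + _).
rewrite [y ^+ D.+2]exprS /shift_var -!mul_mpolyC mpolyCM; ring.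
Qed.

Lemma taylor1_form D f : f \is D.+1.-homog -> exists g : 'I_N -> {mpoly K[N]},
  (forall j, g j \is D.-homog) /\
  f = mevalv f v *: y ^+ D.+1 + \sum_j shift_var j * g j.
Proof.
move=> fD; rewrite [f]mpolyE mevalv_sum scaler_suml.
have: {in msupp f, forall m, mdeg m = D.+1} by apply: dhomog_mf.
elim: (msupp f) => [|m s IH] ms.
  exists (fun=> 0); split=> [j|]; first exact: rpred0.
  by rewrite !big_nil add0r big1 // => j _; rewrite mulr0.
have [|g [gh Eg]] := IH; first by move=> i si; apply: ms; rewrite inE si orbT.
have [|g1 [g1h Eg1]] := @taylor1_monomial D m; first by apply: ms; rewrite mem_head.
exists (fun j => f@_m *: g1 j + g j); split=> [j|].
  by apply: rpredD => //; apply: dhomogZ.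
rewrite !big_cons /= Eg mevalvZ {1}Eg1 scalerDr scalerA -!addrA; congr (_ + _).
under [X in _ = _ + X]eq_bigr do rewrite mulrDr -scalerAr.
by rewrite big_split /= -scaler_sumr addrCA.
Qed.

(** Expanding the coefficients of the first order expansion once more; the
    linear form [L] collects the terms of order 0 and 1. *)
Lemma taylor2_form D f : f \is D.+2.-homog ->
  exists (L : {mpoly K[N]}) (g : 'I_N -> 'I_N -> {mpoly K[N]}),
  [/\ L \is 1.-homog, mevalv L v = mevalv f v &
  f = y ^+ D.+1 * L + \sum_i \sum_j shift_var i * shift_var j * g i j].
Proof.
move=> /taylor1_form [g [gh Eg]].
have [h Eh] : exists h : 'I_N -> 'I_N -> {mpoly K[N]}, forall i,
   g i = mevalv (g i) v *: y ^+ D.+1 + \sum_j shift_var j * h i j.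
  apply: (@fin_all_exists _ _ (fun i h => g i = mevalv (g i) v *: y ^+ D.+1 + \sum_j shift_var j * h j)) => i.
  by have [h [_ ?]] := taylor1_form (gh i); exists h.
exists (mevalv f v *: y + \sum_i mevalv (g i) v *: shift_var i), h; split.
- apply: rpredD; first exact: dhomogZ.
  by apply: rpred_sum => i _; apply/dhomogZ/shift_var_homog.
- rewrite mevalvD mevalvZ yv mulr1 mevalv_sum big1 ?addr0 // => i _.
  by rewrite mevalvZ shift_var_eval mulr0.
rewrite {1}Eg mulrDr -scalerAr -exprSr -addrA; congr (_ + _).
rewrite mulr_sumr -big_split /=; apply: eq_bigr => i _.
rewrite {1}Eh mulrDr -!scalerAr mulr_sumr mulrC; congr (_ + _).
by apply: eq_bigr => j _; rewrite mulrA.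
Qed.

Lemma dvan_linear_eq0 f : f \is 1.-homog -> dvan v f -> f = 0.
Proof.
move=> /dhomogP f1 [_ fj]; apply/mpolyP => m; rewrite mcoeff0.
apply/eqP; apply/contraT; rewrite -mcoeff_msupp => fm.
have := f1 _ fm => /= /eqP; rewrite mdeg_eq1 => /existsP[j /eqP Em].
have: f^`M(j) = (f@_U_(j))%:MP.
  apply/mpolyP => k; rewrite mcoeff_deriv mcoeffC.
  case: (eqVneq k 0%MM) => [->|k0].
    by rewrite add0m mnm0E mulr1.
  rewrite mulr0 (_ : f@_(k + U_(j)) = 0) ?mul0rn //.
  apply/eqP; apply/contraT; rewrite -mcoeff_msupp => /f1 /=.
  by rewrite mdegD mdeg1 addn1 => -[/eqP]; rewrite mdeg_eq0 (negPf k0).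
move=> Ef; have := fj j; rewrite Ef /mevalv mevalC -Em => f0.
by move: fm; rewrite mcoeff_msupp f0 eqxx.
Qed.

(** In degree [D.+1], first order jets at [v] are those of the forms
    [y ^+ D * L] with [L] linear, so they can be computed with linear forms. *)
Lemma jet_linear D f : f \is D.+1.-homog ->
  exists L, [/\ L \is 1.-homog, mevalv L v = mevalv f v &
                dvan v (f - y ^+ D * L)].
Proof.
case: D => [|D] fh.
  by exists f; split=> //; rewrite mul1r subrr; apply: dvan0.
have [L [g [Lh Lv Ef]]] := taylor2_form fh.
exists L; split=> //; rewrite {1}Ef addrC addKr.
apply: dvan_sum => i _; apply: dvan_sum => j _; apply: dvanMr.
by apply: dvan_mul; exact: shift_var_eval.
Qed.

(** A form singular at [v] lies in the square of the ideal generated by the linear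
    forms vanishing at [v]: the linear part [L] of its expansion is itself
    singular at [v], hence zero. *)
Lemma dvan_square D f : f \is D.+1.-homog -> dvan v f ->
  exists g : 'I_N -> 'I_N -> {mpoly K[N]},
  f = \sum_i \sum_j shift_var i * shift_var j * g i j.
Proof.
case: D => [|D] fh vf.
  exists (fun _ _ => 0); rewrite (dvan_linear_eq0 fh vf) big1 // => i _.
  by rewrite big1 // => j _; rewrite mulr0.
have [L [g [Lh Lv Ef]]] := taylor2_form fh; exists g.
suff L0 : L = 0 by rewrite {1}Ef L0 mulr0 add0r.
apply: dvan_linear_eq0 => //; apply: (@dvan_cancel _ _ _ (y ^+ D.+1)).
  by rewrite mevalv_exp yv expr1n oner_eq0.
rewrite -[X in dvan _ X](addrK (\sum_i \sum_j shift_var i * shift_var j * g i j)) -Ef.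
apply: dvanB => //; apply: dvan_sum => i _; apply: dvan_sum => j _.
by apply: dvanMr; apply: dvan_mul; exact: shift_var_eval.
Qed.
End Taylor.

(** * The ideal of a double point scheme *)
Section DoubleIdeal.
Variables (K : fieldType) (n : nat) (S : {fset Pn K n}).
Local Notation R := {mpoly K[n.+1]}.
Implicit Types (f g a b : R).

Lemma vanishing_idealMl g f : vanishing_ideal S f -> vanishing_ideal S (g * f).
Proof. by move=> vf p pS v vp; rewrite mevalvM (vf p pS v vp) mulr0. Qed.

Lemma vanishing_idealMr g f : vanishing_ideal S f -> vanishing_ideal S (f * g).
Proof. by rewrite mulrC; exact: vanishing_idealMl. Qed.

Lemma double_ideal0 : double_ideal S 0.
Proof. by exists [::]; rewrite big_nil; split. Qed.

Lemma double_ideal_mul a b :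
  vanishing_ideal S a -> vanishing_ideal S b -> double_ideal S (a * b).
Proof.
move=> va vb; exists [:: (a, b)]; rewrite big_seq1; split=> // q.
by rewrite inE => /eqP ->.
Qed.

Lemma double_idealD f g :
  double_ideal S f -> double_ideal S g -> double_ideal S (f + g).
Proof.
move=> [s [hs ->]] [s' [hs' ->]]; exists (s ++ s'); rewrite big_cat; split=> //.
by move=> q; rewrite mem_cat => /orP[/hs|/hs'].
Qed.

Lemma double_idealMl g f : double_ideal S f -> double_ideal S (g * f).
Proof.
move=> [s [hs ->]]; exists [seq (g * q.1, q.2) | q <- s]; split.
  by move=> _ /mapP[q /hs [v1 v2] ->]; split=> //; apply: vanishing_idealMl.
by rewrite big_map mulr_sumr; apply: eq_bigr => q _; rewrite mulrA.
Qed.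

Lemma double_idealZ c f : double_ideal S f -> double_ideal S (c *: f).
Proof. by rewrite -mul_mpolyC; exact: double_idealMl. Qed.

Lemma double_idealN f : double_ideal S f -> double_ideal S (- f).
Proof. by rewrite -scaleN1r; exact: double_idealZ. Qed.

Lemma double_idealB f g :
  double_ideal S f -> double_ideal S g -> double_ideal S (f - g).
Proof. by move=> vf vg; apply/double_idealD/double_idealN. Qed.

Lemma double_ideal_sum (I : eqType) (r : seq I) (F : I -> R) :
  (forall i, i \in r -> double_ideal S (F i)) -> double_ideal S (\sum_(i <- r) F i).
Proof.
move=> vF; rewrite big_seq; apply: (big_ind (double_ideal S)) => //.
  exact: double_ideal0.
exact: double_idealD.
Qed.

Lemma double_ideal_dvan f p v : double_ideal S f -> p \in S -> v \in val p ->
  dvan v f.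
Proof.
move=> [s [hs ->]] pS vp; apply: dvan_sum => q /hs[v1 v2].
by apply: dvan_mul; [exact: v1 vp | exact: v2 vp].
Qed.
End DoubleIdeal.

(** With representatives [pt] normalized by one linear form [y], multiplication by
    [y] changes the degree of a form without changing its values on [S], and the
    separators [sep] give forms with arbitrary values on [S]. *)
Section Framed.
Variables (K : fieldType) (n : nat) (S : {fset Pn K n}).
Local Notation R := {mpoly K[n.+1]}.
Variables (pt : Pn K n -> 'rV[K]_n.+1) (y : R).
Hypothesis S_pt : forall p, p \in S -> val p = <[pt p]>%VS.
Hypotheses (hy : y \is 1.-homog) (y_pt : forall p, p \in S -> mevalv y (pt p) = 1).
Variables (N : nat) (sep : Pn K n -> R).
Hypothesis sep_homog : forall p, sep p \is N.-homog.
Hypothesis sep_pt : forall p q, p \in S -> q \in S ->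
  mevalv (sep p) (pt q) = (p == q)%:R.
Implicit Types (f g : R).

Lemma vanishing_ideal_form D f : f \is D.-homog ->
  (forall p, p \in S -> mevalv f (pt p) = 0) -> vanishing_ideal S f.
Proof.
move=> fD f0 p pS v; rewrite S_pt // => /vlineP[c ->].
by rewrite (homog_mevalvZ _ _ fD) f0 // mulr0.
Qed.

Lemma vanishing_ideal_pt f p : vanishing_ideal S f -> p \in S -> mevalv f (pt p) = 0.
Proof. by move=> vf pS; apply: (vf p pS); rewrite S_pt // memv_line. Qed.

Lemma double_ideal_dvan_pt f p : double_ideal S f -> p \in S -> dvan (pt p) f.
Proof. by move=> vf pS; apply: (double_ideal_dvan vf pS); rewrite S_pt // memv_line. Qed.

Definition interp (a : Pn K n -> K) : R := \sum_(p <- S) a p *: sep p.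

Lemma interp_homog a : interp a \is N.-homog.
Proof. by apply: rpred_sum => p _; apply: dhomogZ. Qed.

Lemma interp_pt a q : q \in S -> mevalv (interp a) (pt q) = a q.
Proof.
move=> qS; rewrite mevalv_sum (big_fsetD1 q) //= mevalvZ sep_pt // eqxx mulr1.
rewrite big1_fset ?addr0 // => p; rewrite !inE => /andP[pq pS] _.
by rewrite mevalvZ sep_pt // (negPf pq) mulr0.
Qed.

(** Away from the zeros of ['X_i], the ideal [I_S ^ 2] contains every form singular
    at all points of [S].  Modulo [I_S] a power of ['X_i] is a combination of the
    separators [sep p], so ['X_i ^+ (N + N)] is, modulo terms that multiply [f]
    into [I_S ^ 2], a combination of products of two separators; [sep p ^+ 2 * f]
    is in [I_S ^ 2] because [f] is a sum of products of two forms vanishing at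
    [p], and [sep p * sep q] with [p != q] vanishes on all of [S]. *)
Lemma double_ideal_local D f : f \is D.+1.-homog ->
  (forall p, p \in S -> dvan (pt p) f) ->
  forall i, double_ideal S ('X_i ^+ (N + N) * f).
Proof.
move=> fD vf i.
have fI : vanishing_ideal S f.
  by apply: (vanishing_ideal_form fD) => p /vf[].
pose a p := (pt p) 0 i ^+ N; pose z := 'X_i ^+ N - interp a.
have zI : vanishing_ideal S z.
  apply: (@vanishing_ideal_form N) => [|p pS].
    by apply: rpredB; [have := dhomogMn N (homogX1 K i); rewrite mul1n | exact: interp_homog].
  by rewrite mevalvB mevalv_exp mevalvX interp_pt // subrr.
have -> : 'X_i ^+ (N + N) * f = interp a * interp a * f + z * ((z + 2%:R * interp a) * f).
  by rewrite exprD /z; ring.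
apply: double_idealD; last first.
  by apply: double_ideal_mul => //; apply: vanishing_idealMl.
rewrite /interp !mulr_suml; apply: double_ideal_sum => p pS.
rewrite mulr_sumr mulr_suml; apply: double_ideal_sum => q qS.
rewrite -!scalerAl -scalerAr -scalerAl; do 2!apply: double_idealZ.
have sepI r s : r \in S -> s \in S -> r != s -> mevalv (sep r) (pt s) = 0.
  by move=> rS sS rs; rewrite sep_pt // (negPf rs).
case: (eqVneq p q) => [<-|pq]; last first.
  apply: double_ideal_mul => //; apply: (@vanishing_ideal_form (N + N)) => [|r rS].
    exact: dhomogM.
  rewrite mevalvM; case: (eqVneq p r) => [pr|pr]; last by rewrite sepI ?mul0r.
  by rewrite [X in _ * X]sepI ?mulr0 // -pr eq_sym.
have [g Ef] := dvan_square hy (y_pt pS) fD (vf p pS).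
rewrite Ef mulr_sumr; apply: double_ideal_sum => j _.
rewrite mulr_sumr; apply: double_ideal_sum => k _.
set l := shift_var _ _.
have lI m : vanishing_ideal S (sep p * l m).
  apply: (@vanishing_ideal_form (N + 1)) => [|r rS].
    by apply: dhomogM => //; exact: shift_var_homog.
  rewrite mevalvM; case: (eqVneq p r) => [<-|pr]; last by rewrite sepI ?mul0r.
  by rewrite shift_var_eval ?y_pt // mulr0.
have -> : sep p * sep p * (l j * l k * g j k) = sep p * l j * (sep p * l k * g j k) by ring.
by apply: double_ideal_mul => //; apply: vanishing_idealMr.
Qed.

(** Interpolation inverts [y ^+ e] modulo [I_S]; squaring the defect inverts it
    modulo [I_S ^ 2]. *)
Lemma local_inverse e i : exists r, r \is (N + N + e).-homog /\
  double_ideal S ('X_i ^+ (N + e + (N + e)) - y ^+ e * r).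
Proof.
pose a p := (pt p) 0 i ^+ (N + e); pose z := 'X_i ^+ (N + e) - y ^+ e * interp a.
have zI : vanishing_ideal S z.
  apply: (@vanishing_ideal_form (N + e)) => [|p pS].
    apply: rpredB; first by have := dhomogMn (N + e) (homogX1 K i); rewrite mul1n.
    by rewrite addnC; apply: dhomogM; [exact: linear_form_exp | exact: interp_homog].
  rewrite mevalvB mevalvM !mevalv_exp y_pt // expr1n mul1r mevalvX.
  by rewrite interp_pt // subrr.
exists (interp a * (2%:R * 'X_i ^+ (N + e) - y ^+ e * interp a)); split.
  rewrite -addnA; apply: dhomogM; first exact: interp_homog.
  apply: rpredB.
    rewrite mulr_natl; apply: rpredMn.
    by have := dhomogMn (N + e) (homogX1 K i); rewrite mul1n.
  by rewrite addnC; apply: dhomogM; [exact: linear_form_exp | exact: interp_homog].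
have -> : 'X_i ^+ (N + e + (N + e)) - y ^+ e *
    (interp a * (2%:R * 'X_i ^+ (N + e) - y ^+ e * interp a)) = z * z.
  rewrite exprD /z; ring.
exact: double_ideal_mul.
Qed.
End Framed.

(** * Cohomology of the structure sheaf *)
Section Monomials.
Variables (K : fieldType) (N : nat).
Implicit Types (f g u w : {mpoly K[N]}).

Lemma homogXn (i : 'I_N) k : ('X_i ^+ k : {mpoly K[N]}) \is k.-homog.
Proof. by have := dhomogMn k (homogX1 K i); rewrite mul1n. Qed.

Lemma mpolyX_neq0 (i : 'I_N) : ('X_i : {mpoly K[N]}) != 0.
Proof. by rewrite -msupp_eq0 msuppX. Qed.

Definition low_degree (i : 'I_N) k f := forall m, m \in msupp f -> (m i < k)%N.

Lemma low_degreeB i k f g : low_degree i k f -> low_degree i k g -> low_degree i k (f - g).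
Proof.
by move=> lf lg m /msuppB_le; rewrite mem_cat => /orP[/lf|/lg].
Qed.

Lemma low_degreeMXn i j k l f : i != j -> low_degree i k f -> low_degree i k (f * 'X_j ^+ l).
Proof.
move=> ij lf m; rewrite mpolyXn (perm_mem (msuppMX _ _)) => /mapP[m' /lf m'k ->].
by rewrite mnmDE mulmnE mnm1E eq_sym (negPf ij) mul0n.
Qed.

Lemma low_degree_eq0 i k w : low_degree i k ('X_i ^+ k * w) -> w = 0.
Proof.
move=> lw; apply/eqP; rewrite -msupp_eq0; apply/contraT.
case E: (msupp w) => [|m s] // _.
have: (U_(i) *+ k + m)%MM \in msupp ('X_i ^+ k * w).
  by rewrite mcoeff_msupp mulrC mpolyXn mcoeffMX -mcoeff_msupp E mem_head.
by move/lw; rewrite mnmDE mulmnE mnm1E eqxx; lia.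
Qed.

(** Division by ['X_i ^+ k].  The remainder is unique by [low_degree_eq0], which
    makes it compatible with multiplication by the other variables. *)
Lemma split_low_degree i k D f : f \is (D + k).-homog -> exists u w,
  [/\ f = 'X_i ^+ k * u + w, low_degree i k w & u \is D.-homog].
Proof.
move=> /dhomogP fD.
exists (\sum_(m <- msupp f | (k <= m i)%N) f@_m *: 'X_[m - U_(i) *+ k]).
exists (\sum_(m <- msupp f | (m i < k)%N) f@_m *: 'X_[m]); split.
- rewrite [LHS]mpolyE (bigID (fun m : 'X_{1..N} => k <= m i)%N) /=; congr (_ + _); last first.
    by apply: eq_bigl => m; rewrite -ltnNge.
  rewrite mulr_sumr; apply: eq_bigr => m km.
  rewrite -scalerAr mpolyXn -mpolyXD; congr (_ *: 'X_[_]).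
  apply/mnmP=> j; rewrite mnmDE mnmBE mulmnE mnm1E.
  by case: (eqVneq i j) => [<-|_]; lia.
- move=> m /msupp_sum_le.
  move=> /flattenP[s /mapP[m' ]].
  rewrite mem_filter => /andP[m'k _] -> /msuppZ_le.
  by rewrite msuppX inE => /eqP ->.
- rewrite big_seq_cond; apply: rpred_sum => m /andP[/fD /= mD km].
  apply: dhomogZ; rewrite dhomogX /=.
  have: mdeg (m - U_(i) *+ k + U_(i) *+ k)%MM = (D + k)%N.
    rewrite -mD; congr mdeg; apply/mnmP=> j; rewrite mnmDE mnmBE mulmnE mnm1E.
    by case: (eqVneq i j) => [<-|_]; lia.
  rewrite mdegD mdegMn mdeg1; lia.
Qed.

(** Two distinct variables are coprime. *)
Lemma variable_power_divides i j k l D f g : i != j -> f \is (D + k).-homog ->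
  'X_j ^+ l * f = 'X_i ^+ k * g -> exists2 u, f = 'X_i ^+ k * u & u \is D.-homog.
Proof.
move=> ij /(split_low_degree i)[u [w [Ef lw uD]]] E; exists u => //.
suff: 'X_j ^+ l * w = 0.
  move/eqP; rewrite mulf_eq0 expf_eq0 (negPf (mpolyX_neq0 j)) andbF /= => /eqP w0.
  by rewrite Ef w0 addr0.
have E2 : 'X_j ^+ l * w = 'X_i ^+ k * (g - 'X_j ^+ l * u).
  by rewrite mulrBr -E Ef; ring.
rewrite E2 (_ : g - _ = 0) ?mulr0 //.
by apply: (@low_degree_eq0 i k); rewrite -E2 mulrC; exact: low_degreeMXn.
Qed.
End Monomials.

Section FractionIdentities.
Variable L : fieldType.

Lemma clear_denominators (zo zj zl yj yl z gl gj : L) :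
  zo != 0 -> zj != 0 -> zl != 0 -> yj != 0 -> yl != 0 ->
  gl / (zo * zl) - gj / (zo * zj) = z / (yj * yl) ->
  yj * yl * (zj * gl - zl * gj) = zo * (zj * zl) * z.
Proof.
move=> nzo nzj nzl nyj nyl E.
transitivity (zo * (zj * zl) * (yj * yl) * (gl / (zo * zl) - gj / (zo * zj))).
  by field; rewrite nzo nzj nzl.
by rewrite E; field; rewrite nyj nyl.
Qed.

Lemma partial_fractions (zo zj u a : L) : zo != 0 -> zj != 0 ->
  (zo * u + zj * a) / (zo * zj) = u / zj + a / zo.
Proof. by move=> nzo nzj; field; rewrite nzo nzj. Qed.

Lemma sub_common_part (hi hj P xj xi : L) : xj != 0 -> xi != 0 ->
  (hj - xj * P) / xj - (hi - xi * P) / xi = hj / xj - hi / xi.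
Proof. by move=> nj ni; field; rewrite nj ni. Qed.

Lemma cancel_common_factor (g x z : L) : x != 0 -> z != 0 -> g / z = x * g / (z * x).
Proof. by move=> nx nz; field; rewrite nx nz. Qed.

Lemma glue_denominators (xi xj yi yj Gi Gj g : L) :
  xi != 0 -> xj != 0 -> yi != 0 -> yj != 0 ->
  Gj / xj - Gi / xi = g / (yi * yj) ->
  yi * yj * (xi * Gj - xj * Gi) = xi * xj * g.
Proof.
move=> ni nj mi mj E.
transitivity (yi * yj * xi * xj * (Gj / xj - Gi / xi)).
  by field; rewrite ni nj.
by rewrite E; field; rewrite mi mj.
Qed.

Lemma common_denominator (G ri rj xi xj : L) : xi != 0 -> xj != 0 ->
  G * rj / xj - G * ri / xi = G * (rj * xi - ri * xj) / (xi * xj).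
Proof. by move=> ni nj; field; rewrite ni nj. Qed.

Lemma difference_denominator (a u g x z : L) : x != 0 -> z != 0 ->
  (a * (u * z) - x * g) / (x * z) = a * (u / x) - g / z.
Proof. by move=> nx nz; field; rewrite nx nz. Qed.

Lemma equal_differences (a fi fj bi bj : L) :
  a * (fj - fi) = bj - bi -> a * fi - bi = a * fj - bj.
Proof.
move=> E; apply/eqP; rewrite -subr_eq0; apply/eqP.
have -> : a * fi - bi - (a * fj - bj) = bj - bi - a * (fj - fi) by ring.
by rewrite E subrr.
Qed.
End FractionIdentities.

Section StructureSheaf.
Variables (K : fieldType) (n : nat).
Local Notation R := {mpoly K[n.+1]}.
Local Notation F := {fraction {mpoly K[n.+1]}}.

Lemma tofracX_neq0 (i : 'I_n.+1) k : tofrac ('X_i : R) ^+ k != 0.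
Proof. by rewrite expf_eq0 tofrac_eq0 (negPf (mpolyX_neq0 _ _)) andbF. Qed.

(** Local sections of degree [d] that agree as fractions come from one form: it
    suffices that powers of two of the variables are coprime. *)
Lemma H0_structure_sheaf d (h : 'I_n.+1 -> R) (k : 'I_n.+1 -> nat) : (0 < n)%N ->
  (forall i, h i \is (d + k i).-homog) ->
  (forall i j, tofrac (h i) / tofrac 'X_i ^+ k i = tofrac (h j) / tofrac 'X_j ^+ k j) ->
  exists2 P : R, P \is d.-homog & forall i, h i = 'X_i ^+ k i * P.
Proof.
move=> n0 hh E.
have E2 i j : 'X_j ^+ k j * h i = 'X_i ^+ k i * h j.
  apply/eqP; rewrite -tofrac_eq; apply/eqP; rewrite !tofracM !tofracXn.
  have := E i j => /(congr1 (fun z => z * (tofrac 'X_i ^+ k i * tofrac 'X_j ^+ k j))).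
  rewrite mulrA mulfVK ?tofracX_neq0 // [tofrac 'X_i ^+ _ * _]mulrC mulrA.
  by rewrite mulfVK ?tofracX_neq0 // mulrC => ->; rewrite mulrC.
have ij : (ord0 : 'I_n.+1) != Ordinal (n0 : (1 < n.+1)%N) by [].
have [P E0 Ph] := variable_power_divides ij (hh ord0) (E2 _ _).
exists P => // i; apply: (mulfI (_ : 'X_ord0 ^+ k ord0 != 0)).
  by rewrite expf_eq0 (negPf (mpolyX_neq0 _ _)) andbF.
by rewrite E2 E0; ring.
Qed.


Lemma tofrac_injective : injective (fun f : R => tofrac f : F).
Proof. by move=> f g /eqP; rewrite tofrac_eq => /eqP. Qed.

(** Write [c 0 j] over a common denominator [('X_0 * 'X_j) ^+ k] and divide its
    numerator by ['X_0 ^+ k].  The remainders give the part of [c 0 j] that has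
    a pole along ['X_0]; since [c j l] has no such pole, this part does not
    depend on [j], and comparing two indices different from 0 (hence the
    condition [2 <= n]) shows that it has no pole along ['X_j].  It is therefore
    a section on the chart of index 0, and subtracting it leaves a section on
    the chart of index [j]. *)
Lemma H1_structure_sheaf d (c : 'I_n.+1 -> 'I_n.+1 -> F) : (2 <= n)%N ->
  (forall i j, exists m (g : R), g \is (d + m * 2).-homog /\
     c i j = tofrac g / tofrac ('X_i * 'X_j) ^+ m) ->
  (forall i j l, c j l - c i l + c i j = 0) ->
  exists k (h : 'I_n.+1 -> R), (forall i, h i \is (d + k).-homog) /\
    forall i j, c i j = tofrac (h j) / tofrac 'X_j ^+ k - tofrac (h i) / tofrac 'X_i ^+ k.
Proof.
move=> n2 hc cocy; pose o : 'I_n.+1 := ord0.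
have {cocy} cE i j : c i j = c o j - c o i.
  by rewrite -[RHS]addr0 -(cocy o i j); ring.
have c00 : c o o = 0 by rewrite cE subrr.
have [k [g [gh Eg]]] : exists k (g : 'I_n.+1 -> R),
    (forall j, g j \is (d + k + k).-homog) /\
    forall j, c o j = tofrac (g j) / tofrac ('X_o * 'X_j) ^+ k.
  have [m /fin_all_exists[g hg]] := fin_all_exists (hc o).
  pose k := (\sum_j m j)%N.
  have mk j : (m j <= k)%N by rewrite /k (bigD1 j) //= leq_addr.
  exists k, (fun j => g j * ('X_o * 'X_j) ^+ (k - m j)); split=> j; have [gh Eg] := hg j.
    have -> : (d + k + k = (d + m j * 2) + 2 * (k - m j))%N by have := mk j; lia.
    apply: dhomogM => //; apply: dhomogMn.
    by apply: (@dhomogM _ _ _ 1 _ 1); exact: homogX1.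
  have {2}-> : k = (k - m j + m j)%N by rewrite subnK.
  rewrite Eg tofracM; set e := (k - m j)%N.
  rewrite exprD !tofracM tofracXn tofracM [_ ^+ e * _]mulrC -mulf_div divff ?mulr1 //.
  by rewrite expf_eq0 mulf_eq0 !tofrac_eq0 !(negPf (mpolyX_neq0 _ _)) andbF.
have [u /fin_all_exists[w uw]] := fin_all_exists (fun j => split_low_degree o (gh j)).
(* the parts with a pole along 'X_o agree *)
have key j l : j != o -> l != o -> 'X_j ^+ k * w l = 'X_l ^+ k * w j.
  move=> jo lo; have [m [f [_ Ef]]] := hc j l.
  have E : ('X_j * 'X_l) ^+ m * ('X_j ^+ k * g l - 'X_l ^+ k * g j)
       = 'X_o ^+ k * ('X_j * 'X_l) ^+ k * f.
    apply: tofrac_injective; move: Ef; rewrite cE !Eg.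
    rewrite !(tofracM, tofracB, tofracXn) => Ef.
    have nzo := tofracX_neq0 o k; have nzj := tofracX_neq0 j k.
    have nzl := tofracX_neq0 l k.
    have nzj' := tofracX_neq0 j m; have nzl' := tofracX_neq0 l m.
    rewrite !exprMn in Ef *.
    exact: (clear_denominators nzo nzj nzl nzj' nzl' Ef).
  have [El lwl _] := uw l; have [Ej lwj _] := uw j.
  apply/eqP; rewrite -subr_eq0; apply/eqP.
  have : ('X_j * 'X_l) ^+ m * ('X_j ^+ k * w l - 'X_l ^+ k * w j) = 0.
    have E2 : ('X_j * 'X_l) ^+ m * ('X_j ^+ k * w l - 'X_l ^+ k * w j) =
      'X_o ^+ k * (('X_j * 'X_l) ^+ k * f - ('X_j * 'X_l) ^+ m *
         ('X_j ^+ k * u l - 'X_l ^+ k * u j)).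
      by rewrite [RHS]mulrBr ['X_o ^+ k * (_ * f)]mulrA -E El Ej; ring.
    rewrite E2 (_ : _ - _ = 0) ?mulr0 //.
    apply: (@low_degree_eq0 _ _ o k); rewrite -E2 exprMn mulrC mulrA.
    do 2![apply: low_degreeMXn; first by rewrite eq_sym].
    by apply: low_degreeB; rewrite mulrC; apply: low_degreeMXn => //; rewrite eq_sym.
  move/eqP; rewrite mulf_eq0 expf_eq0 mulf_eq0 !(negPf (mpolyX_neq0 _ _)) andbF /=.
  by move/eqP.
have n1 : (1 < n.+1)%N by lia.
pose o1 : 'I_n.+1 := Ordinal n1; pose o2 : 'I_n.+1 := Ordinal (n2 : (2 < n.+1)%N).
have wh j : w j \is (d + k + k).-homog.
  have [Ej _ uj] := uw j; have -> : w j = g j - 'X_o ^+ k * u j by rewrite {1}Ej addrC addKr.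
  apply: rpredB => //.
  by have := dhomogM (homogXn K o k) uj; rewrite addnC.
have o12 : o1 != o2 by [].
have [a Ea ah] := variable_power_divides o12 (wh o1) (key o2 o1 isT isT).
have wE j : j != o -> w j = 'X_j ^+ k * a.
  move=> jo; apply: (mulfI (_ : 'X_o1 ^+ k != 0)).
    by rewrite expf_eq0 (negPf (mpolyX_neq0 _ _)) andbF.
  by rewrite key // Ea; ring.
exists k, (fun j => if j == o then - a else u j); split=> [i|].
  by case: ifP => _; [rewrite rpredN | have [] := uw i].
suff H j : c o j = tofrac (if j == o then - a else u j) / tofrac 'X_j ^+ k
    + tofrac a / tofrac 'X_o ^+ k.
  by move=> i j; rewrite cE !H; ring.
case: eqVneq => [->|jo]; first by rewrite c00 tofracN mulNr addNr.
have [Ej _ _] := uw j; rewrite Eg Ej wE // !(tofracM, tofracD, tofracXn) exprMn.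
exact: (partial_fractions _ _ (tofracX_neq0 o k) (tofracX_neq0 j k)).
Qed.
End StructureSheaf.

(** * Linear forms on a rational normal curve *)
Section Parametrized.
Variables (K : fieldType) (n : nat) (psi : 'I_n.+1 -> {poly K}).
Local Notation R := {mpoly K[n.+1]}.
Implicit Types (f g : R) (b : {poly K}) (t : K).

Definition curve_pt t : 'rV[K]_n.+1 := \row_i (psi i).[t].
Definition pullback f : {poly K} := mmap (@polyC K) psi f.
Definition coef_mx : 'M[K]_n.+1 := \matrix_(i, j) (psi i)`_j.

Hypothesis psi_size : forall i, (size (psi i) <= n.+1)%N.

Lemma pullbackM f g : pullback (f * g) = pullback f * pullback g.
Proof. exact: rmorphM. Qed.
Lemma pullbackB f g : pullback (f - g) = pullback f - pullback g.
Proof. exact: rmorphB. Qed.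
Lemma pullbackXn f k : pullback (f ^+ k) = pullback f ^+ k.
Proof. exact: rmorphXn. Qed.
Lemma pullbackX i : pullback 'X_i = psi i.
Proof. by rewrite /pullback mmapX mmap1U. Qed.
Lemma pullbackZ c f : pullback (c *: f) = c *: pullback f.
Proof. by rewrite /pullback mmapZ mul_polyC. Qed.
Lemma pullback_prod (I : Type) (r : seq I) (P : pred I) (G : I -> R) :
  pullback (\prod_(i <- r | P i) G i) = \prod_(i <- r | P i) pullback (G i).
Proof. exact: rmorph_prod. Qed.

Lemma pullback_horner f t : (pullback f).[t] = mevalv f (curve_pt t).
Proof.
rewrite /pullback /mevalv /meval /mmap /mmap1 horner_sum.
apply: eq_bigr => m _; rewrite hornerM hornerC horner_prod; congr (_ * _).
by apply: eq_bigr => i _; rewrite horner_exp mxE.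
Qed.

Lemma pullback_size D f : f \is D.-homog -> (size (pullback f) <= (n * D).+1)%N.
Proof.
move=> /dhomogP fD; rewrite /pullback /mmap big_seq.
apply: (big_ind (fun q : {poly K} => size q <= (n * D).+1)%N) => [|a b sa sb|m /fD /= mD].
- by rewrite size_poly0.
- by rewrite (leq_trans (size_polyD _ _)) // geq_max sa.
rewrite mul_polyC (leq_trans (size_scale_leq _ _)) // -mD mdegE /mmap1.
apply: (leq_trans (size_prod_leq _ _)).
rewrite big_distrr /= leq_subLR.
have H i : (size (psi i ^+ m i) <= (n * m i).+1)%N.
  apply: (leq_trans (size_poly_exp_leq _ _)); rewrite ltnS leq_mul2r; have := psi_size i; lia.
have : (\sum_(i < n.+1) size (psi i ^+ m i) <= \sum_(i < n.+1) (n * m i + 1))%N.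
  by apply: leq_sum => i _; rewrite addn1.
rewrite big_split /= sum_nat_const card_ord muln1.
by move=> h; rewrite addnS ltnS addnC (leq_trans h).
Qed.

Hypothesis psi_unit : coef_mx \in unitmx.

(** The linear form that restricts to the polynomial [b] on the curve; its
    coefficients are those of [b] in the basis [psi]. *)
Definition lin b : R := \sum_i ((\row_j b`_j) *m invmx coef_mx) 0 i *: 'X_i.

Lemma lin_homog b : lin b \is 1.-homog.
Proof. by apply: rpred_sum => i _; apply/dhomogZ/homogX1. Qed.

Lemma linP a b c : lin (a *: b + c) = a *: lin b + lin c.
Proof.
rewrite /lin scaler_sumr -big_split /=; apply: eq_bigr => i _.
rewrite scalerA -scalerDl; congr (_ *: _).
have -> : \row_j (a *: b + c)`_j = a *: \row_j b`_j + \row_(j < n.+1) c`_j.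
  by apply/rowP=> j; rewrite !mxE coefD coefZ.
by rewrite mulmxDl -scalemxAl !mxE.
Qed.

Lemma lin_eval (w : 'rV[K]_n.+1) b :
  mevalv (lin b) w = ((\row_j b`_j) *m invmx coef_mx *m w^T) 0 0.
Proof.
by rewrite mevalv_sum [RHS]mxE; apply: eq_bigr => i _; rewrite mevalvZ mevalvX !mxE.
Qed.

Lemma pullback_lin b : (size b <= n.+1)%N -> pullback (lin b) = b.
Proof.
move=> sb; rewrite /lin /pullback raddf_sum /=.
apply/polyP=> j; rewrite coef_sum.
under eq_bigr do rewrite -/(pullback _) pullbackZ pullbackX coefZ.
case: (ltnP j n.+1) => jn; last first.
  rewrite (nth_default _ (leq_trans sb jn)) big1 // => i _.
  by rewrite (nth_default _ (leq_trans (psi_size i) jn)) mulr0.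
transitivity (((\row_j b`_j) *m invmx coef_mx *m coef_mx) 0 (Ordinal jn)).
  by rewrite [RHS]mxE; apply: eq_bigr => i _; rewrite [coef_mx _ _]mxE.
by rewrite mulmxKV // mxE.
Qed.

Lemma lin_pt b t : (size b <= n.+1)%N -> mevalv (lin b) (curve_pt t) = b.[t].
Proof. by move=> sb; rewrite -pullback_horner pullback_lin. Qed.

(** The linear forms restricting to the monomials are coordinates of the whole
    space; a relation between them is refuted by evaluating it at such a [w]. *)
Lemma lin_dual (j : 'I_n.+1) : exists w : 'rV[K]_n.+1,
  forall b, mevalv (lin b) w = b`_j.
Proof.
exists (\row_i coef_mx i j) => b; rewrite lin_eval.
have -> : (\row_i coef_mx i j)^T = col j coef_mx by apply/colP=> i; rewrite !mxE.
by rewrite colE mulmxA mulmxKV // -colE !mxE.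
Qed.

Lemma lin_onto f : f \is 1.-homog -> exists2 b : {poly K}, (size b <= n.+1)%N & f = lin b.
Proof.
move=> f1; exists (pullback f); first by have := pullback_size f1; rewrite muln1.
have Ef : f = \sum_i f@_U_(i) *: 'X_i.
  apply/mpolyP=> m; rewrite raddf_sum /=.
  under eq_bigr do rewrite mcoeffZ mcoeffX.
  case: (boolP (mdeg m == 1%N)) => [|m1].
    rewrite mdeg_eq1 => /existsP[j /eqP ->].
    rewrite (bigD1 j) //= eqxx mulr1 big1 ?addr0 // => i ij.
    by rewrite eq_mnm1 (negPf ij) mulr0.
  rewrite big1 => [|i _]; first exact: (dhomog_nemf_coeff f1).
  by case: (eqVneq U_(i)%MM m) m1 => [<-|_ _]; rewrite ?mdeg1 ?eqxx // mulr0.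
rewrite {1}Ef /lin; apply: eq_bigr => i _; congr (_ *: _).
have -> : \row_j (pullback f)`_j = (\row_i f@_U_(i)) *m coef_mx.
  apply/rowP=> j; rewrite !mxE {1}Ef /pullback raddf_sum /= coef_sum.
  by apply: eq_bigr => k _; rewrite -/(pullback _) pullbackZ pullbackX coefZ !mxE.
by rewrite mulmxK // mxE.
Qed.

End Parametrized.

(** * An affine parametrization *)
Section Hyperplanes.
Variables (K : fieldType) (N : nat).

Lemma hyperplane_containing (U : {vspace 'rV[K]_N}) : U <> fullv ->
  exists2 c : 'rV[K]_N, c != 0 & forall v, v \in U -> v *m c^T = 0.
Proof.
move=> Uf; pose g := (\1 - projv U)%VF.
have gU v : v \in U -> g v = 0.
  by move=> vU; rewrite !lfunE /= !lfunE /= projv_id // subrr.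
have [v gv] : exists v, g v != 0.
  exists (vpick (U^C)%VS).
  have C0 : (U^C)%VS != 0%VS.
    apply: contra_notN Uf => /eqP C0.
    by have := addv_complf U; rewrite C0 addv0.
  apply/eqP; rewrite !lfunE /= !lfunE /= => /eqP; rewrite subr_eq0 => /eqP E.
  have: vpick (U^C)%VS \in (U :&: U^C)%VS by rewrite memv_cap memv_pick {1}E memv_proj.
  by rewrite capv_compl memv0 vpick0 (negPf C0).
have [j gj] : exists j, g v 0 j != 0.
  by apply/existsP; apply: contraNT gv => /existsPn g0; apply/eqP/rowP=> j; rewrite mxE; have /negPn/eqP := g0 j.
have E w : g w 0 j = (w *m (\row_i g (delta_mx 0 i) 0 j)^T) 0 0.
  rewrite {1}[w]row_sum_delta raddf_sum summxE mxE; apply: eq_bigr => i _.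
  by rewrite !mxE /= linearZ mxE.
exists (\row_i g (delta_mx 0 i) 0 j) => [|w /gU gw].
  by apply: contraNneq gj => c0; rewrite E c0 trmx0 mulmx0 mxE.
by apply/rowP=> k; rewrite ord1 [RHS]mxE -E gw mxE.
Qed.

Lemma hyperplane_of (c : 'rV[K]_N) : c != 0 -> exists2 U : {vspace 'rV[K]_N},
  U <> fullv & forall v, (v \in U) = (v *m c^T == 0).
Proof.
move=> c0; exists (lker (linfun (mulmxr c^T))) => [U|v].
  case/eqP: c0; apply/rowP=> i; rewrite mxE.
  have := memvf (delta_mx 0 i : 'rV[K]_N); rewrite -U memv_ker lfunE => /eqP.
  by rewrite /= -rowE => /rowP/(_ 0); rewrite !mxE.
by rewrite memv_ker lfunE.
Qed.
End Hyperplanes.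

Section RationalNormalCurve.
Variables (K : closedFieldType) (n : nat).

Lemma closed_field_notin (s : seq K) : exists c, c \notin s.
Proof.
pose q := \prod_(a <- s) ('X - a%:P) * 'X + 1 : {poly K}.
have [|c qc] := @closed_rootP K q _.
  rewrite size_polyDl ?size_poly1 ?size_mulX ?monic_neq0 ?monic_prod_XsubC //.
    by rewrite size_prod_XsubC.
  by rewrite size_prod_XsubC.
exists c; apply/negP => cs.
move: qc; rewrite /root /q !hornerE (_ : (\prod_(a <- s) ('X - a%:P)).[c] = 0).
  by rewrite mul0r add0r oner_eq0.
by apply/eqP; rewrite -/(root _ c) root_prod_XsubC.
Qed.

(** If [q] vanished off 0 without being zero, [q * 'X + 1] would be a nonconstant
    polynomial equal to 1 everywhere. *)
Lemma poly_zero_off0 (q : {poly K}) : (forall c, c != 0 -> q.[c] = 0) -> q = 0.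
Proof.
move=> q0; apply/eqP/contraT => nq.
have [c] : exists c, ~~ root (q * 'X + 1) c.
  by exists 0; rewrite /root !hornerE oner_eq0.
have [|c' /eqP] := @closed_rootP K (q * 'X + 1) _.
  rewrite size_polyDl ?size_poly1 ?size_mulX //; move: nq; rewrite -size_poly_gt0; lia.
rewrite !hornerE; case: (eqVneq c' 0) => [->|/q0 ->].
  by rewrite mulr0 add0r => /eqP; rewrite oner_eq0.
by rewrite mul0r add0r => /eqP; rewrite oner_eq0.
Qed.

Lemma vlineZ (V : vectType K) (a : K) (v : V) : a != 0 -> <[a *: v]>%VS = <[v]>%VS.
Proof.
move=> a0; apply/eqP; rewrite eqEsubv -!memvE memvZ ?memv_line //=.
by apply/vlineP; exists a^-1; rewrite scalerA mulVf // scale1r.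
Qed.

Lemma fset_choice (T : choiceType) (X : Type) (x0 : X) (A : {fset T}) (P : T -> X -> Prop) :
  (forall p, p \in A -> exists x, P p x) -> exists f, forall p, p \in A -> P p (f p).
Proof.
move=> h; have [f hf] := fin_all_exists (fun p : A => h (val p) (valP p)).
exists (fun p => oapp f x0 [pick q : A | val q == p]) => p pA.
case: pickP => [q /eqP <-|/(_ (FSetSub pA))] /=; first exact: hf.
by rewrite eqxx.
Qed.

(** Take for point at infinity of the line a point [(1, c)] that parametrizes no
    point of [S].  A linear relation between the polynomials obtained would be a
    hyperplane containing [C]: the form it defines vanishes at the finite
    parameters by homogeneity and at infinity because a polynomial vanishing
    off 0 is zero.  The spanning condition excludes such a hyperplane. *)
Lemma curve_parametrization (C : Pn K n -> Prop) (S : {fset Pn K n}) :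
  rational_normal_curve C -> (forall p, p \in S -> C p) ->
  exists (psi : 'I_n.+1 -> {poly K}) (t : Pn K n -> K),
  [/\ forall i, (size (psi i) <= n.+1)%N, coef_mx psi \in unitmx &
      forall p, p \in S -> val p = <[curve_pt psi (t p)]>%VS].
Proof.
move=> [phi [phi_h _ _ _ [CE Cspan]]] SC.
pose vec (a b : K) : 'rV[K]_2 := \row_j (if j == 0 then a else b).
have vecE (u : 'rV[K]_2) : u = vec (u 0 0) (u 0 1).
  apply/rowP=> j; rewrite mxE; case: eqVneq => [->|j0] //.
  by congr (u _ _); apply/val_inj; case: j j0 => -[|[|]].
have [u hu] : exists u : Pn K n -> 'rV[K]_2, forall p, p \in S ->
    u p != 0 /\ val p = <[param_pt phi (u p)]>%VS.
  apply: (fset_choice (0 : 'rV[K]_2)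
    (P := fun p u => u != 0 /\ val p = <[param_pt phi u]>%VS)) => p /SC /CE[u u0 E].
  by exists u.
have [c hc] := closed_field_notin [seq (u p) 0 1 / (u p) 0 0 | p <- S].
pose line j : {poly K} := if j == 0 :> 'I_2 then 'X else c *: 'X + 1.
have lineE t : curve_pt line t = vec t (c * t + 1).
  by apply/rowP=> j; rewrite !mxE /line; case: ifP; rewrite !hornerE.
pose psi i := pullback line (phi i).
have psiE t : curve_pt psi t = param_pt phi (vec t (c * t + 1)).
  by apply/rowP=> i; rewrite !mxE pullback_horner lineE.
have psi_size i : (size (psi i) <= n.+1)%N.
  have := @pullback_size K 1 line _ n (phi i) (phi_h i); rewrite mul1n; apply=> j.
  rewrite /line; case: ifP => _; first by rewrite size_polyX.
  rewrite (leq_trans (size_polyD _ _)) // geq_max size_poly1 andbT.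
  by rewrite (leq_trans (size_scale_leq _ _)) // size_polyX.
have homogE (f : {mpoly K[2]}) a b : f \is n.-homog -> b - c * a != 0 ->
    mevalv f (vec a b) = (b - c * a) ^+ n * mevalv f (vec (a / (b - c * a)) (c * (a / (b - c * a)) + 1)).
  move=> fh e0; rewrite -homog_mevalvZ //; congr mevalv.
  by apply/rowP=> j; rewrite !mxE; case: ifP => _; field.
exists psi, (fun p => u p 0 0 / (u p 0 1 - c * u p 0 0)); split=> //.
  rewrite -row_free_unit; apply: inj_row_free => w w0; apply/eqP/contraT => wn0.
  have [U Un0 memU] := hyperplane_of wn0; case: Un0; apply: Cspan => p /CE[v v0 ->].
  rewrite -memvE memU; apply/eqP/rowP=> k; rewrite ord1 [RHS]mxE => {k}.
  pose f : {mpoly K[2]} := \sum_i w 0 i *: phi i.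
  have fh : f \is n.-homog by apply: rpred_sum => i _; apply/dhomogZ/phi_h.
  have -> : (param_pt phi v *m w^T) 0 0 = mevalv f v.
    rewrite mevalv_sum mxE; apply: eq_bigr => i _.
    by rewrite mevalvZ !mxE mulrC.
  have f0 t : mevalv f (vec t (c * t + 1)) = 0.
    rewrite -lineE -pullback_horner; suff -> : pullback line f = 0 by rewrite horner0.
    apply/polyP=> j; rewrite /pullback raddf_sum coef_sum coef0 /=.
    under eq_bigr do rewrite -/(pullback line _) pullbackZ coefZ -/(psi _).
    case: (ltnP j n.+1) => jn; last first.
      by rewrite big1 // => i _; rewrite (nth_default _ (leq_trans (psi_size i) jn)) mulr0.
    have /rowP/(_ (Ordinal jn)) := w0; rewrite !mxE => w0j.
    by rewrite -[RHS]w0j; apply: eq_bigr => i _; rewrite mxE.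
  have f1 a b : b - c * a != 0 -> mevalv f (vec a b) = 0.
    by move=> e0; rewrite homogE // f0 mulr0.
  rewrite (vecE v); set a := v 0 0; set b := v 0 1.
  (* approach the parameter (a, b) along a line meeting infinity at e = 0 *)
  pose line' j : {poly K} := if j == 0 :> 'I_2 then a%:P else 'X + (c * a)%:P.
  have line'E e : mevalv f (vec a (e + c * a)) = (pullback line' f).[e].
    rewrite pullback_horner; congr mevalv; apply/rowP=> j; rewrite !mxE /line'.
    by case: ifP; rewrite !hornerE.
  rewrite -[b](subrK (c * a)) line'E (_ : pullback line' f = 0) ?horner0 //.
  by apply: poly_zero_off0 => e e0; rewrite -line'E f1 // addrK.
move=> p pS; have [u0 ->] := hu p pS.
have e0 : u p 0 1 - c * u p 0 0 != 0.
  rewrite subr_eq0; apply: contraNneq hc => E; apply/mapP; exists p => //.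
  rewrite E mulfK //; apply: contraNneq u0 => a0.
  by apply/eqP; rewrite (vecE (u p)) E a0 mulr0; apply/rowP=> j; rewrite !mxE if_same.
rewrite psiE -[RHS](vlineZ _ (expf_neq0 n e0)); congr <[_]>%VS.
by apply/rowP=> i; rewrite !mxE -homogE // -vecE.
Qed.
End RationalNormalCurve.

(** * Forms with prescribed first order jets *)
Section Lagrange.
Variables (K : fieldType).

Lemma prodXsubC_eval_neq0 (I : eqType) (r : seq I) (P : pred I) (F : I -> K) a :
  (forall i, i \in r -> P i -> a != F i) -> (\prod_(i <- r | P i) ('X - (F i)%:P)).[a] != 0.
Proof.
move=> h; rewrite horner_prod prodf_seq_neq0; apply/allP => i ir; apply/implyP => Pi.
by rewrite !hornerE subr_eq0 h.
Qed.

Lemma size_prod_others n (q : 'I_n -> K) i :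
  size (\prod_(j | j != i) ('X - (q j)%:P)) = n.
Proof.
rewrite (eq_bigl (fun j => j \in predC1 i)) // -big_enum size_prod_XsubC -cardE.
by rewrite cardC1 card_ord prednK // (leq_ltn_trans _ (ltn_ord i)).
Qed.

Lemma lagrange_basis n (q : 'I_n -> K) (g : {poly K}) : injective q ->
  (size g <= n)%N ->
  exists c : 'I_n -> K, g = \sum_i c i *: \prod_(j | j != i) ('X - (q j)%:P).
Proof.
move=> qinj sg; pose B i := \prod_(j | j != i) ('X - (q j)%:P).
exists (fun i => g.[q i] / (B i).[q i]); apply/eqP; rewrite -subr_eq0; apply/contraT => nz.
have Bnz i : (B i).[q i] != 0.
  by apply: prodXsubC_eval_neq0 => j _; apply: contraNneq => /qinj ->.
have uq : uniq [seq q i | i <- enum 'I_n] by rewrite map_inj_uniq ?enum_uniq.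
have rts : all (root (g - \sum_i g.[q i] / (B i).[q i] *: B i)) [seq q i | i <- enum 'I_n].
  apply/allP => _ /mapP[i _ ->].
  rewrite /root hornerD hornerN horner_sum (bigD1 i) //= hornerZ mulfVK //.
  rewrite big1 ?addr0 ?subrr // => j ji.
  rewrite hornerZ (_ : (B j).[q i] = 0) ?mulr0 //.
  by rewrite /B (bigD1 i) 1?eq_sym //= hornerM hornerXsubC subrr mul0r.
have := max_poly_roots nz rts uq; rewrite size_map -cardE card_ord ltnNge => /negP; case.
rewrite (leq_trans (size_polyD _ _)) // geq_max sg size_polyN.
apply: (big_ind (fun q : {poly K} => size q <= n)%N) => [|a b sa sb|i _].
- by rewrite size_poly0.
- by rewrite (leq_trans (size_polyD _ _)) // geq_max sa.
by rewrite (leq_trans (size_scale_leq _ _)) // size_prod_others.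
Qed.
End Lagrange.

Section Jets.
Variables (K : fieldType) (n : nat) (psi : 'I_n.+1 -> {poly K}).
Hypothesis psi_size : forall i, (size (psi i) <= n.+1)%N.
Hypothesis psi_unit : coef_mx psi \in unitmx.
Local Notation R := {mpoly K[n.+1]}.
Local Notation lin := (lin psi).
Local Notation pt := (curve_pt psi).

Lemma lin1_homog : lin 1 \is 1.-homog. Proof. exact: lin_homog. Qed.
Lemma lin1_pt t : mevalv (lin 1) (pt t) = 1.
Proof. by rewrite lin_pt ?size_poly1 // hornerE. Qed.

(** Cutting a list of parameters into consecutive pieces of length [n] gives
    hyperplanes through the corresponding points of the curve; their product is
    singular at a point whose parameter occurs in two pieces.  Beyond its
    end the list is continued with [z]. *)
Section Chunks.
Variables (z : K) (s : seq K).

Definition chunk c : {poly K} := \prod_(j < n) ('X - (nth z s (c * n + j))%:P).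
Definition chunks k : R := \prod_(c < k) lin (chunk c).

Lemma chunk_size c : (size (chunk c) <= n.+1)%N.
Proof. by rewrite /chunk -big_enum size_prod_XsubC -cardE card_ord. Qed.

Lemma chunks_homog k : chunks k \is k.-homog.
Proof.
rewrite /chunks; elim: k => [|k IH]; first by rewrite big_ord0 dhomog1.
by rewrite big_ord_recr /=; have := dhomogM IH (lin_homog psi (chunk k)); rewrite addn1.
Qed.

Lemma lin_chunk_pt j : (0 < n)%N -> mevalv (lin (chunk (j %/ n))) (pt (nth z s j)) = 0.
Proof.
move=> n0; rewrite lin_pt ?chunk_size // /chunk.
rewrite (bigD1 (Ordinal (ltn_pmod j n0))) //= -divn_eq.
by rewrite !hornerE subrr mul0r.
Qed.

Lemma chunks_pt k j : (0 < n)%N -> (j < k * n)%N -> mevalv (chunks k) (pt (nth z s j)) = 0.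
Proof.
move=> n0 jk; have jk' : (j %/ n < k)%N by rewrite ltn_divLR.
by rewrite /chunks (bigD1 (Ordinal jk')) //= mevalvM lin_chunk_pt // mul0r.
Qed.

(** Two occurrences at distance at least [n] lie in different pieces. *)
Lemma chunks_dvan k j1 j2 : (0 < n)%N -> (j2 < k * n)%N -> (j1 + n <= j2)%N ->
  nth z s j1 = nth z s j2 -> dvan (pt (nth z s j1)) (chunks k).
Proof.
move=> n0 jk j12 E.
have jk2 : (j2 %/ n < k)%N by rewrite ltn_divLR.
have jlt : (j1 %/ n < j2 %/ n)%N.
  by apply: leq_trans (leq_div2r n j12); rewrite divnDr // divnn n0 addn1.
have jk1 : (j1 %/ n < k)%N by apply: ltn_trans jk2.
rewrite /chunks (bigD1 (Ordinal jk1)) //= (bigD1 (Ordinal jk2)) /=; last first.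
  by rewrite -val_eqE /= gtn_eqF.
rewrite mulrA; apply: dvanMr; apply: dvan_mul; first exact: lin_chunk_pt.
by rewrite E lin_chunk_pt.
Qed.

Lemma chunks_neq0 k a : z != a -> a \notin s -> mevalv (chunks k) (pt a) != 0.
Proof.
move=> za sa; rewrite mevalv_prod prodf_seq_neq0; apply/allP => c _ /=.
rewrite lin_pt ?chunk_size //; apply: prodXsubC_eval_neq0 => j _ _.
case: (ltnP (c * n + j) (size s)) => h; last by rewrite nth_default // eq_sym.
by apply: contraNneq sa => ->; rewrite mem_nth.
Qed.
End Chunks.

(** For each [i < n], the list [s i] contains every parameter of [ts] twice, except
    the first [n] ones other than [q i], which it contains once; the hyperplanes
    [lin (g * B i)], with [g] of degree at most 1, contain the latter.  So the
    products [M i * lin (g * B i)] are singular at all points of [ts].  At [t0],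
    those with [g = 'X - t0] have linear parts that span the linear forms
    vanishing at that point, because the polynomials [B i] form a Lagrange basis,
    and the one with [g = 1] does not vanish.  Together they realize every first
    order jet. *)
Lemma prescribed_jet D (ts : seq K) t0 (h : R) : (0 < n)%N -> uniq ts -> t0 \notin ts ->
  (n.*2 <= (size ts).+1)%N -> ((size ts).*2 < n * D.+1)%N -> h \is D.+1.-homog ->
  exists P : R, [/\ P \is D.+1.-homog, forall t, t \in ts -> dvan (pt t) P &
                 dvan (pt t0) (P - h)].
Proof.
move=> n0 uts t0ts nm mD hh.
have nts : (n <= size ts)%N by lia.
pose z := nth t0 ts 0.
have ts0 : (0 < size ts)%N by apply: leq_trans nts.
have z0 : z != t0 by apply: contraNneq t0ts => <-; exact: mem_nth.
pose q (i : 'I_n) := nth z ts i.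
have qts i : q i \in ts by rewrite mem_nth // (leq_trans (ltn_ord i)).
have qinj : injective q.
  move=> i j /eqP; rewrite nth_uniq ?(leq_trans (ltn_ord _)) // => /eqP.
  exact: val_inj.
(* equal entries of s i are at distance at least n, as 2n - 1 <= size ts *)
pose s i := ts ++ q i :: drop n ts.
have ss i : (size (s i) <= D * n)%N.
  by rewrite size_cat /= size_drop; move: mD nts; rewrite mulnS; lia.
pose M i := chunks z (s i) D.
have Mh i : M i \is D.-homog by exact: chunks_homog.
have M0 i : mevalv (M i) (pt t0) != 0.
  apply: chunks_neq0 => //; rewrite mem_cat inE !negb_or t0ts /=.
  rewrite (contraNneq _ t0ts) => [|->] //=.
  by apply: contra t0ts; exact: mem_drop.
pose B i := \prod_(j | j != i) ('X - (q j)%:P).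
have sB i : (size (B i) <= n)%N.
  by rewrite /B size_prod_others.
have MB i (g : {poly K}) : (size g <= 2)%N ->
    [/\ (size (g * B i)%R <= n.+1)%N, M i * lin (g * B i) \is D.+1.-homog &
        forall t, t \in ts -> dvan (pt t) (M i * lin (g * B i))].
  move=> sg; have sgB : (size (g * B i)%R <= n.+1)%N.
    rewrite (leq_trans (size_polyMleq _ _)) // -subn1 leq_subLR add1n -[n.+2]add2n.
    exact: leq_add sg (sB i).
  split=> //; first by have := dhomogM (Mh i) (lin_homog psi (g * B i)); rewrite addn1.
  move=> t tts; pose j := index t ts.
  have jm : (j < size ts)%N by rewrite index_mem.
  have Et : t = nth z (s i) j by rewrite nth_cat jm nth_index.
  have sj : size (s i) = (size ts + 1 + (size ts - n))%N.
    by rewrite size_cat /= size_drop; lia.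
  have := ss i; rewrite sj => ssi.
  case: (ltnP j n) => jn; last first.
    apply: dvanMr; rewrite Et; apply: (@chunks_dvan _ _ _ _ (size ts + 1 + (j - n))) => //; try lia.
    rewrite !nth_cat jm ltnNge -addnA leq_addr /= addKn add1n /= nth_drop subnKC //.
  case: (eqVneq (Ordinal jn) i) => [ji|ji].
    apply: dvanMr; rewrite Et; apply: (@chunks_dvan _ _ _ _ (size ts)) => //; try lia.
    by rewrite !nth_cat jm ltnn subnn /= /q -ji.
  apply: dvan_mul; first by rewrite Et chunks_pt //; lia.
  rewrite lin_pt // hornerM /B (bigD1 (Ordinal jn)) //= hornerM hornerXsubC /q /= nth_index //.
  by rewrite subrr mul0r mulr0.
pose o := Ordinal n0.
have [] := MB o 1; rewrite ?size_poly1 // mul1r => sBo P0h P0ts.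
set P0 := M o * lin (B o) in P0h P0ts.
have P00 : mevalv P0 (pt t0) != 0.
  rewrite mevalvM mulf_neq0 // lin_pt //.
  by apply: prodXsubC_eval_neq0 => i _ _; apply: contraNneq t0ts => ->.
(* up to y ^ D, the jets of P0 and h at t0 are those of lin b0 and lin b *)
have [L0 [L0h L0v E0]] := jet_linear lin1_homog (lin1_pt t0) P0h.
have [L [Lh Lv E]] := jet_linear lin1_homog (lin1_pt t0) hh.
have [b sb Eb] := lin_onto psi_size psi_unit Lh.
have [b0 sb0 Eb0] := lin_onto psi_size psi_unit L0h.
have b00 : b0.[t0] != 0 by rewrite -(lin_pt psi_size psi_unit _ sb0) -Eb0 L0v.
pose c := b.[t0] / b0.[t0].
have /factor_theorem[g Eg] : root (b - c *: b0) t0.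
  by rewrite /root !hornerE mulfVK // subrr.
have sg : (size g <= n)%N.
  case: (eqVneq g 0) => [->|g0]; first by rewrite size_poly0.
  have : (size (b - c *: b0)%R <= n.+1)%N.
    rewrite (leq_trans (size_polyD _ _)) // geq_max sb size_polyN.
    by rewrite (leq_trans (size_scale_leq _ _)).
  by rewrite Eg size_Mmonic ?monicXsubC // size_XsubC addn2.
have [a Ea] := lagrange_basis qinj sg.
have sX : (size ('X - t0%:P : {poly K})%R <= 2)%N by rewrite size_XsubC.
pose P1 i := M i * lin (('X - t0%:P) * B i).
have P1E i : dvan (pt t0) ((mevalv (M i) (pt t0))^-1 *: P1 i - lin 1 ^+ D * lin (('X - t0%:P) * B i)).
  rewrite /P1 scalerAl -mulrBl; have [sXB _ _] := MB i _ sX.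
  apply: dvan_mul; last by rewrite lin_pt // !hornerE subrr mul0r.
  by rewrite mevalvB mevalvZ mulVf // mevalv_exp lin1_pt expr1n subrr.
exists (c *: P0 + \sum_i (a i / mevalv (M i) (pt t0)) *: P1 i); split.
- apply: rpredD; first exact: dhomogZ.
  by apply: rpred_sum => i _; apply: dhomogZ; have [] := MB i _ sX.
- move=> t tts; apply: dvanD; first by apply/dvanZ/P0ts.
  by apply: dvan_sum => i _; apply: dvanZ; have [_ _] := MB i _ sX; apply.
have linE : L = c *: L0 + \sum_i a i *: lin (('X - t0%:P) * B i).
  have -> : \sum_i a i *: lin (('X - t0%:P) * B i) = lin (\sum_i a i *: (('X - t0%:P) * B i)).
      apply: (big_rec2 (fun u w => u = lin w)) => [|i u w _ ->]; last by rewrite linP.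
    by have := linP psi (-1) 0 0; rewrite scaler0 addr0 scaleN1r addNr.
  rewrite Eb Eb0 -linP; congr lin.
  under eq_bigr do rewrite scalerAr; rewrite -mulr_sumr -Ea mulrC -Eg.
  by rewrite addrC subrK.
have -> : c *: P0 + \sum_i (a i / mevalv (M i) (pt t0)) *: P1 i - h
   = c *: (P0 - lin 1 ^+ D * L0)
    + \sum_i a i *: ((mevalv (M i) (pt t0))^-1 *: P1 i - lin 1 ^+ D * lin (('X - t0%:P) * B i))
    - (h - lin 1 ^+ D * L).
  under [X in _ = _ + X - _]eq_bigr do rewrite scalerBr scalerA [_ *: (lin 1 ^+ D * _)]scalerAr.
  rewrite sumrB -mulr_sumr linE -!mul_mpolyC; ring.
apply: dvanB => //; apply: dvanD; first exact: dvanZ.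
by apply: dvan_sum => i _; apply: dvanZ.
Qed.
End Jets.

(** * Cech cohomology and jets *)
Section Cech.
Variables (K : fieldType) (n : nat).
Local Notation R := {mpoly K[n.+1]}.
Local Notation F := {fraction {mpoly K[n.+1]}}.
Implicit Types (I : R -> Prop).

Definition idx1 (i : 'I_n.+1) : {ffun 'I_1 -> 'I_n.+1} := [ffun=> i].
Definition idx2 (i j : 'I_n.+1) : {ffun 'I_2 -> 'I_n.+1} :=
  [ffun k : 'I_2 => if val k == 0%N then i else j].
Definition idx3 (i j l : 'I_n.+1) : {ffun 'I_3 -> 'I_n.+1} :=
  [ffun k : 'I_3 => if val k == 0%N then i else if val k == 1%N then j else l].

Lemma idx1E (s : {ffun 'I_1 -> 'I_n.+1}) : s = idx1 (s ord0).
Proof. by apply/ffunP=> k; rewrite ffunE ord1. Qed.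

Lemma idx2E (s : {ffun 'I_2 -> 'I_n.+1}) : s = idx2 (s ord0) (s ord_max).
Proof.
apply/ffunP=> k; rewrite ffunE; case: k => -[|[|]] // k2 /=.
  by congr (s _); apply/val_inj.
by congr (s _); apply/val_inj.
Qed.

Lemma cech_diff0E (b : cochain K n 0) i j :
  cech_diff b (idx2 i j) = b (idx1 j) - b (idx1 i).
Proof.
rewrite /cech_diff big_ord_recl big_ord1 /= mul1r expr1 mulN1r.
by congr (_ - _); congr (b _); apply/ffunP=> k; rewrite (ord1 k) !ffunE.
Qed.

Lemma cech_diff1E (c : cochain K n 1) i j l :
  cech_diff c (idx3 i j l) = c (idx2 j l) - c (idx2 i l) + c (idx2 i j).
Proof.
rewrite /cech_diff 2!big_ord_recl big_ord1 /= mul1r expr1 mulN1r.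
rewrite -signr_odd /= mul1r addrA.
by congr (c _ - c _ + c _); apply/ffunP=> -[[|[|]] // k2]; rewrite !ffunE.
Qed.

Lemma idx3E (s : {ffun 'I_3 -> 'I_n.+1}) : s = idx3 (s ord0) (s (inord 1)) (s ord_max).
Proof.
apply/ffunP=> k; rewrite ffunE; case: k => -[|[|[|]]] // k2 /=;
 congr (s _); apply/val_inj; rewrite //= inordK //.
Qed.

Lemma sections1 I d b i : sections I d 1 (\prod_(j < 1) 'X_(idx1 i j)) b <->
  exists k (g : R), [/\ I g, g \is (d + k).-homog & b = tofrac g / tofrac 'X_i ^+ k].
Proof.
rewrite /sections big_ord1 ffunE.
by split=> -[k [g]]; rewrite ?muln1 => H; exists k, g; rewrite ?muln1.
Qed.

Lemma sections2 I d c i j : sections I d 2 (\prod_(k < 2) 'X_(idx2 i j k)) c <->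
  exists k (g : R), [/\ I g, g \is (d + k * 2).-homog &
    c = tofrac g / tofrac ('X_i * 'X_j) ^+ k].
Proof. by rewrite /sections big_ord_recl big_ord1 !ffunE. Qed.

Lemma h_pos0_of_form (S : {fset Pn K n}) d (f : R) : f != 0 -> f \is d.-homog ->
  (forall i, exists k, double_ideal S ('X_i ^+ k * f)) -> h_pos 0 S d.
Proof.
move=> f0 fd fS; exists (fun _ _ => tofrac f); split=> [_|a H j].
  split=> [s|s].
    rewrite (idx1E s); apply/sections1; have [k kI] := fS (s ord0).
    exists k, ('X_(s ord0) ^+ k * f); split=> //.
      by rewrite addnC; apply: dhomogM => //; exact: homogXn.
    by rewrite tofracM tofracXn [_ ^+ k * _]mulrC mulfK // tofracX_neq0.
  by rewrite (idx2E s) cech_diff0E subrr.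
have /eqP := H [ffun=> ord0]; rewrite big_ord1 -tofracM tofrac_eq0 mul_mpolyC.
rewrite scaler_eq0 (negPf f0) orbF => /eqP a0; by rewrite (ord1 j).
Qed.
End Cech.

Section FramedCohomology.
Variables (K : fieldType) (n : nat) (S : {fset Pn K n}).
Local Notation R := {mpoly K[n.+1]}.
Local Notation F := {fraction {mpoly K[n.+1]}}.
Variables (pt : Pn K n -> 'rV[K]_n.+1) (y : R).
Hypothesis S_pt : forall p, p \in S -> val p = <[pt p]>%VS.
Hypotheses (hy : y \is 1.-homog) (y_pt : forall p, p \in S -> mevalv y (pt p) = 1).
Variables (N : nat) (sep : Pn K n -> R).
Hypothesis sep_homog : forall p, sep p \is N.-homog.
Hypothesis sep_pt : forall p q, p \in S -> q \in S ->
  mevalv (sep p) (pt q) = (p == q)%:R.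

Lemma pt_coord p : p \in S -> exists i, pt p 0 i != 0.
Proof.
move=> pS; apply/existsP/contraT => /existsPn p0.
have := y_pt pS; have -> : pt p = 0 *: pt p.
  by apply/rowP=> i; rewrite mxE mul0r; have /negPn/eqP := p0 i.
by rewrite (homog_mevalvZ _ _ hy) mul0r => /eqP; rewrite eq_sym oner_eq0.
Qed.

(** The jets at [p] of the local sections [h i / 'X_i ^+ k] bounding the cocycle do
    not depend on [i], since the cocycle has values in [I_S ^ 2].  A form [P] of
    degree [d] with these jets, subtracted from the sections, makes them sections
    of [I_S ^ 2]. *)
Lemma h_zero1_of_jets d : (2 <= n)%N ->
  (forall p i k (h : R), p \in S -> pt p 0 i != 0 -> h \is (d + k).-homog ->
    exists P : R, [/\ P \is d.-homog,
      forall q, q \in S -> q != p -> dvan (pt q) P &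
      dvan (pt p) (h - 'X_i ^+ k * P)]) ->
  h_zero 1 S d.
Proof.
move=> n2 prescribed_jet [c [hc hind]]; pose c0 := c ord0.
have [c0S c0Z] := hc ord0; rewrite -/c0 in c0S c0Z.
have c0s i j : exists k (g : R), [/\ double_ideal S g, g \is (d + k * 2).-homog &
    c0 (idx2 i j) = tofrac g / tofrac ('X_i * 'X_j) ^+ k].
  by apply/sections2; exact: c0S.
have [k [h [hh Eh]]] : exists k (h : 'I_n.+1 -> R), (forall i, h i \is (d + k).-homog) /\
    forall i j, c0 (idx2 i j) = tofrac (h j) / tofrac 'X_j ^+ k - tofrac (h i) / tofrac 'X_i ^+ k.
  apply: (H1_structure_sheaf (c := fun i j => c0 (idx2 i j))) => //.
    by move=> i j; have [m [g [_ gh E]]] := c0s i j; exists m, g.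
  by move=> i j l; rewrite -cech_diff1E c0Z.
have [P [Ph PS]] : exists P : R, P \is d.-homog /\ forall p, p \in S ->
    exists2 i, pt p 0 i != 0 & dvan (pt p) (h i - 'X_i ^+ k * P).
  have [P PP] : exists P : Pn K n -> R, forall p, p \in S ->
     [/\ P p \is d.-homog, forall q, q \in S -> q != p -> dvan (pt q) (P p) &
     exists2 i, pt p 0 i != 0 & dvan (pt p) (h i - 'X_i ^+ k * P p)].
    apply: (fset_choice (0 : R) (P := fun p Q =>
     [/\ Q \is d.-homog, forall q, q \in S -> q != p -> dvan (pt q) Q &
     exists2 i, pt p 0 i != 0 & dvan (pt p) (h i - 'X_i ^+ k * Q)])) => p pS.
    have [i pi] := pt_coord pS.
    by have [Q [Qh Qq Qp]] := prescribed_jet p i k _ pS pi (hh i); exists Q; split=> //; exists i.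
  exists (\sum_(p <- S) P p); split.
    by rewrite big_seq; apply: rpred_sum => p /PP[].
  move=> p pS; have [_ _ [i pi Hi]] := PP p pS; exists i => //.
  rewrite (big_fsetD1 p) //= mulrDr opprD addrA; apply: dvanB => //.
  apply: dvanMl; rewrite big_seq_cond.
  apply: (big_ind (dvan (pt p))) => [||q]; [exact: dvan0|exact: dvanD|].
  by rewrite andbT !inE => /andP[qp qS]; have [_ H _] := PP q qS; apply: H; rewrite // eq_sym.
pose G i := h i - 'X_i ^+ k * P.
have Gh i : G i \is (d + k).-homog.
  by apply: rpredB => //; rewrite addnC; apply: dhomogM => //; exact: homogXn.
have Gglue i j : tofrac (G j) / tofrac 'X_j ^+ k - tofrac (G i) / tofrac 'X_i ^+ k
    = c0 (idx2 i j).
  rewrite /G !tofracB !tofracM !tofracXn Eh.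
  exact: (sub_common_part _ _ _ (tofracX_neq0 K j k) (tofracX_neq0 K i k)).
(* the factor 'X_i ^+ 2 makes the form singular also where 'X_i vanishes *)
have GS i p : p \in S -> dvan (pt p) ('X_i ^+ 2 * G i).
  move=> pS; have [pi|pi] := eqVneq (pt p 0 i) 0.
    by rewrite expr2 -mulrA; apply: dvan_mul; rewrite ?mevalvM mevalvX pi ?mul0r.
  apply: dvanMl; have [j pj Hj] := PS p pS.
  have [l [g [gI _ Eg]]] := c0s i j; rewrite -Gglue in Eg.
  have E : ('X_i * 'X_j) ^+ l * ('X_i ^+ k * G j - 'X_j ^+ k * G i) = ('X_i * 'X_j) ^+ k * g.
    apply: tofrac_injective.
    rewrite tofracM [tofrac (_ - 'X_j ^+ k * G i)]tofracB !(tofracM, tofracXn) !exprMn.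
    rewrite tofracM exprMn in Eg.
    exact: (glue_denominators (tofracX_neq0 K i k) (tofracX_neq0 K j k)
      (tofracX_neq0 K i l) (tofracX_neq0 K j l) Eg).
  have D1 : dvan (pt p) ('X_i ^+ k * G j - 'X_j ^+ k * G i).
    apply: (@dvan_cancel _ _ _ (('X_i * 'X_j) ^+ l)).
      by rewrite mevalv_exp mevalvM !mevalvX expf_neq0 // mulf_neq0.
    by rewrite E; apply/dvanMl/(double_ideal_dvan_pt S_pt gI).
  apply: (@dvan_cancel _ _ _ ('X_j ^+ k)); first by rewrite mevalv_exp mevalvX expf_neq0.
  rewrite -[_ * _](subKr ('X_i ^+ k * G j)); apply: dvanB => //.
  by apply: dvanMl.
suff cob : coboundary (double_ideal S) d (fun s => \sum_(j < 1) tofrac 1%:MP * c j s).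
  by have /eqP := hind (fun=> 1) cob ord0; rewrite oner_eq0.
exists (fun s => tofrac (G (s ord0)) / tofrac 'X_(s ord0) ^+ k); split=> s.
  rewrite (idx1E s); apply/sections1; rewrite ffunE; set i := s ord0.
  exists (N + N + 2 + k)%N, ('X_i ^+ (N + N) * ('X_i ^+ 2 * G i)).
  have G2 : 'X_i ^+ 2 * G i \is (d + k).+2.-homog.
    by have := dhomogM (homogXn K i 2) (Gh i).
  split.
  - exact: (double_ideal_local S_pt hy y_pt sep_homog sep_pt G2 (GS i)).
  - have := dhomogM (homogXn K i (N + N)) G2.
    by congr (_ \is _.-homog); lia.
  rewrite mulrA -exprD tofracM tofracXn [(N + N + 2 + k)%N]addnC [_ ^+ (k + _)]exprD.
  exact: (cancel_common_factor _ (tofracX_neq0 K i (N + N + 2)) (tofracX_neq0 K i k)).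
by rewrite big_ord1 mpolyC1 tofrac1 mul1r (idx2E s) cech_diff0E !ffunE Gglue.
Qed.
End FramedCohomology.

(** * Points on a rational normal curve *)
Section CurvePoints.
Variables (K : fieldType) (n : nat) (psi : 'I_n.+1 -> {poly K}).
Hypothesis psi_size : forall i, (size (psi i) <= n.+1)%N.
Hypothesis psi_unit : coef_mx psi \in unitmx.
Variables (S : {fset Pn K n}) (t : Pn K n -> K).
Hypothesis S_t : forall p, p \in S -> val p = <[curve_pt psi (t p)]>%VS.
Local Notation R := {mpoly K[n.+1]}.
Local Notation F := {fraction {mpoly K[n.+1]}}.
Local Notation lin := (lin psi).
Local Notation pt p := (curve_pt psi (t p)).
Local Notation y := (lin 1).

Lemma param_inj : {in S &, injective t}.
Proof. by move=> p q pS qS E; apply/val_inj; rewrite !S_t // E. Qed.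

Lemma y_pt p : p \in S -> mevalv y (pt p) = 1.
Proof. by move=> _; exact: lin1_pt. Qed.

Lemma homog_prod_seq (I : eqType) (r : seq I) (f : I -> R) k :
  (forall i, i \in r -> f i \is k.-homog) -> \prod_(i <- r) f i \is (k * size r).-homog.
Proof.
elim: r => [|i r IH] h; first by rewrite big_nil muln0 dhomog1.
rewrite big_cons mulnS; apply: dhomogM; first by apply: h; rewrite mem_head.
by apply: IH => j jr; apply: h; rewrite inE jr orbT.
Qed.

Lemma separators : (0 < n)%N -> exists N (sep : Pn K n -> R),
  (forall p, sep p \is N.-homog) /\
  (forall p q, p \in S -> q \in S -> mevalv (sep p) (pt q) = (p == q)%:R).
Proof.
move=> n0; pose f p : R := \prod_(q <- (S `\ p)%fset) lin ('X - (t q)%:P).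
have sX a : (size ('X - a%:P : {poly K})%R <= n.+1)%N by rewrite size_XsubC.
have f0 p q : p \in S -> q \in S -> (mevalv (f p) (pt q) == 0) = (p != q).
  move=> pS qS; rewrite mevalv_prod; apply/idP/idP => [|pq].
    rewrite prodf_seq_eq0 => /hasP[r /=]; rewrite !inE => /andP[rp rS].
    rewrite lin_pt // !hornerE subr_eq0 => /eqP/param_inj E.
    by rewrite E // eq_sym.
  rewrite (big_fsetD1 q) /=; last by rewrite !inE eq_sym pq.
  by rewrite lin_pt // hornerXsubC subrr mul0r.
exists #|` S|.-1, (fun p => if p \in S then (mevalv (f p) (pt p))^-1 *: f p else 0).
split=> [p|p q pS qS].
  case: ifP => pS; last exact: rpred0.
  apply: dhomogZ; rewrite (cardfsD1 p S) pS /=.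
  by rewrite -[X in X.-homog]mul1n; apply: homog_prod_seq => q _; exact: lin_homog.
rewrite pS mevalvZ; case: eqVneq => [<-|pq]; first by rewrite mulVf // f0 // negbK.
by have := f0 p q pS qS; rewrite pq => /eqP ->; rewrite mulr0.
Qed.

Lemma curve_points_span : (n < #|` S|)%N -> spans S.
Proof.
move=> nS; apply/eqP/contraT => /eqP /hyperplane_containing[c c0 hc].
pose b : {poly K} := \sum_i c 0 i *: psi i.
have bt p : p \in S -> b.[t p] = 0.
  move=> pS; have pU : curve_pt psi (t p) \in (\sum_(p <- S) val p)%VS.
    rewrite (big_fsetD1 p) //=; apply: (subvP (addvSl _ _)).
    by rewrite S_t // memv_line.
  have /rowP/(_ 0) := hc _ pU; rewrite !mxE => E; rewrite horner_sum -[RHS]E.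
  by apply: eq_bigr => i _; rewrite hornerZ !mxE mulrC.
have b0 : b = 0.
  apply/eqP/contraT => bn0.
  have := max_poly_roots bn0 (_ : all (root b) [seq t p | p <- S]).
  rewrite map_inj_in_uniq; last exact: param_inj.
  rewrite fset_uniq size_map => /(_ _ isT) H; have: (#|` S| < size b)%N.
    by apply: H; apply/allP => _ /mapP[p pS ->]; rewrite /root bt.
  rewrite ltnNge; apply: contraNT => _; apply: leq_trans nS.
  apply: (big_ind (fun q : {poly K} => size q <= n.+1)%N) => [|u w su sw|i _].
  - by rewrite size_poly0.
  - by rewrite (leq_trans (size_polyD _ _)) // geq_max su.
  by rewrite (leq_trans (size_scale_leq _ _)).
case/negP: c0; rewrite -(mulmxK psi_unit c) (_ : c *m _ = 0) ?mul0mx //.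
apply/rowP=> j; rewrite !mxE -[RHS](coef0 K j) -b0 coef_sum.
by apply: eq_bigr => i _; rewrite coefZ mxE.
Qed.

Lemma double_ideal_pullback f p : double_ideal S f -> p \in S ->
  ('X - (t p)%:P) ^+ 2 %| pullback psi f.
Proof.
move=> [s [hs ->]] pS; rewrite /pullback raddf_sum /= big_seq.
apply: (big_ind (fun g => ('X - (t p)%:P) ^+ 2 %| g)) => [||q /hs[v1 v2]].
- exact: dvdp0.
- by move=> *; rewrite dvdp_addr.
rewrite -/(pullback _ _) pullbackM expr2; apply: dvdp_mul; rewrite dvdp_XsubCl /root.
  by rewrite pullback_horner (vanishing_ideal_pt (pt := fun p => pt p) S_t v1 pS).
by rewrite pullback_horner (vanishing_ideal_pt (pt := fun p => pt p) S_t v2 pS).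
Qed.

Lemma prod_squares_dvdp (rs : seq K) (f : {poly K}) : uniq rs ->
  (forall a, a \in rs -> ('X - a%:P) ^+ 2 %| f) ->
  (\prod_(a <- rs) ('X - a%:P)) ^+ 2 %| f.
Proof.
elim: rs => [|a rs IH] /=; first by rewrite big_nil expr1n dvd1p.
move=> /andP[ars urs] h; rewrite big_cons exprMn Gauss_dvdp.
  rewrite h ?mem_head // IH // => b brs; apply: h.
  by rewrite inE brs orbT.
by rewrite coprimep_expl // coprimep_expr // coprimep_sym coprimep_XsubC root_prod_XsubC.
Qed.

(** On the curve, [G] vanishes to order 1 at [p1] and to order 2 at the other
    points of [S].  If the cocycle defined by [G / y ^ e] were a coboundary,
    [a0 * G - y ^ e * P] would be singular along [S] for some form [P] of degree
    [d].  As [y] restricts to 1, the restriction of [P] would vanish at least to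
    the orders of that of [G], at more than its degree [n * d] many points counted
    with multiplicity, so it would be zero and [a0 * G] would vanish to order 2
    at [p1]. *)
Lemma h_pos1_many_points d : (0 < n)%N -> (n * d + 2 <= (#|` S|).*2)%N -> h_pos 1 S d.
Proof.
move=> n0 nd.
have [N [sep [seph sepp]]] := separators n0.
have yh : y \is 1.-homog by exact: lin_homog.
have [p1 p1S] : exists p, p \in S.
  by apply/fset0Pn; apply/eqP => S0; move: nd; rewrite S0 cardfs0; lia.
pose x := #|` S|; have xE : x = (#|` (S `\ p1)%fset|).+1 by rewrite /x (cardfsD1 p1 S) p1S.
have [e de] : exists e, (d + e)%N = (1 + 2 * #|` (S `\ p1)%fset|)%N.
  exists (1 + 2 * #|` (S `\ p1)%fset| - d)%N; rewrite subnKC //.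
  by have := leq_pmull d n0; move: nd; rewrite -/x xE; lia.
have sX a : (size ('X - a%:P : {poly K})%R <= n.+1)%N by rewrite size_XsubC.
pose G : R := lin ('X - (t p1)%:P) * \prod_(q <- (S `\ p1)%fset) (lin ('X - (t q)%:P) ^+ 2).
have Gh : G \is (d + e).-homog.
  rewrite de; apply: dhomogM; first exact: lin_homog.
  apply: homog_prod_seq => q _; rewrite -[X in X.-homog]mul1n.
  by apply: dhomogMn; exact: lin_homog.
pose M := (N + e + (N + e))%N.
have [r hr] := fin_all_exists (fun i => local_inverse S_t yh y_pt seph sepp e i).
rewrite -/M in hr.
pose phi i : F := tofrac (G * r i) / tofrac 'X_i ^+ M.
pose c : cochain K n 1 := fun s => phi (s ord_max) - phi (s ord0).
exists (fun=> c); split=> [_|a [b [bS bE]] j].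
  split=> s; last by rewrite (idx3E s) cech_diff1E /c !ffunE /=; ring.
  rewrite (idx2E s); set i := s ord0; set j := s ord_max; apply/sections2.
  exists M, (G * (r j * 'X_i ^+ M - r i * 'X_j ^+ M)); split.
  - apply: double_idealMl.
    have -> : r j * 'X_i ^+ M - r i * 'X_j ^+ M
      = r j * ('X_i ^+ M - y ^+ e * r i) - r i * ('X_j ^+ M - y ^+ e * r j) by ring.
    by apply: double_idealB; apply: double_idealMl; apply: (hr _).2.
  - have -> : (d + M * 2 = d + e + (N + N + e + M))%N by rewrite /M; lia.
    apply: dhomogM => //; apply: rpredB; apply: dhomogM; by [exact: (hr _).1|exact: homogXn].
  rewrite /c /phi !ffunE /= !(tofracM, tofracB, tofracXn) exprMn.
  exact: (common_denominator _ _ _ (tofracX_neq0 K i M) (tofracX_neq0 K j M)).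
rewrite (ord1 j) {j}; set a0 := a ord0; apply/eqP/contraT => a0n.
have bs i : exists k (g : R), [/\ double_ideal S g, g \is (d + k).-homog &
    b (idx1 i) = tofrac g / tofrac 'X_i ^+ k] by apply/sections1; exact: bS.
have [k /fin_all_exists[g gP]] := fin_all_exists bs.
pose h i : R := a0 *: (G * r i * 'X_i ^+ k i) - 'X_i ^+ M * g i.
have hE i : tofrac (h i) / tofrac 'X_i ^+ (M + k i) = tofrac a0%:MP * phi i - b (idx1 i).
  have [_ _ ->] := gP i; rewrite /h /phi -mul_mpolyC.
  rewrite tofracB !tofracM !tofracXn exprD.
  exact: (difference_denominator _ _ _ (tofracX_neq0 K i M) (tofracX_neq0 K i (k i))).
have [P Ph hP] : exists2 P : R, P \is d.-homog & forall i, h i = 'X_i ^+ (M + k i) * P.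
  apply: H0_structure_sheaf => // [i|i j].
    rewrite /h; have [_ gh _] := gP i; apply: rpredB.
      apply: dhomogZ; have -> : (d + (M + k i) = d + e + (N + N + e) + k i)%N by rewrite /M; lia.
      by apply: dhomogM; [apply: dhomogM => //; exact: (hr _).1 | exact: homogXn].
    by have := dhomogM (homogXn K i M) gh; rewrite addnCA.
  rewrite !hE; have := bE (idx2 i j); rewrite big_ord1 cech_diff0E /c !ffunE /= => E.
  exact: (equal_differences E).
(* so a0 G - y ^ e P is locally in the ideal I_S ^ 2 *)
have vI i : double_ideal S ('X_i ^+ (M + k i) * (a0 *: G - y ^+ e * P)).
  have [gI _ _] := gP i; have [_ rI] := hr i.
  have -> : 'X_i ^+ (M + k i) * (a0 *: G - y ^+ e * P)
     = (a0 *: G * 'X_i ^+ k i) * ('X_i ^+ M - y ^+ e * r i) + y ^+ e * 'X_i ^+ M * g i.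
    have := hP i; rewrite /h => E; rewrite mulrBr mulrCA -E exprD -!mul_mpolyC; ring.
  by apply: double_idealD; apply: double_idealMl.
have pbG : pullback psi G = ('X - (t p1)%:P) * (\prod_(a <- [seq t q | q <- (S `\ p1)%fset]) ('X - a%:P)) ^+ 2.
  rewrite pullbackM pullback_lin // pullback_prod; congr (_ * _).
  rewrite big_map -prodrXl; apply: eq_bigr => q _.
  by rewrite pullbackXn pullback_lin.
pose W := \prod_(a <- [seq t q | q <- (S `\ p1)%fset]) ('X - a%:P).
have Wn : ~~ root W (t p1).
  rewrite /W root_prod_XsubC; apply/mapP => -[q]; rewrite !inE => /andP[qp1 qS] E.
  by case/eqP: qp1; apply: param_inj.
have D p : p \in S -> ('X - (t p)%:P) ^+ 2 %| a0 *: pullback psi G - pullback psi P.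
  move=> pS; have [i] := pt_coord (pt := fun p => pt p) yh y_pt pS; rewrite mxE => pi.
  have := double_ideal_pullback (vI i) pS.
  rewrite pullbackM pullbackXn pullbackX pullbackB pullbackZ pullbackM pullbackXn.
  rewrite pullback_lin ?size_poly1 // expr1n mul1r Gauss_dvdpr //.
  by rewrite coprimep_expl // coprimep_expr // coprimep_sym coprimep_XsubC.
have P0 : pullback psi P = 0.
  have dP : ('X - (t p1)%:P) * W ^+ 2 %| pullback psi P.
    rewrite Gauss_dvdp; last by rewrite coprimep_expr // coprimep_sym coprimep_XsubC.
    apply/andP; split.
      have := dvdp_trans (dvdp_exp2l _ (isT : (1 <= 2)%N)) (D p1 p1S); rewrite expr1.
      by rewrite pbG dvdp_subr // dvdpZr // dvdp_mulr.
    apply: prod_squares_dvdp => [|_ /mapP[q qS1 ->]].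
      rewrite map_inj_in_uniq ?fset_uniq // => q1 q2; rewrite !inE => /andP[_ h1] /andP[_ h2].
      exact: param_inj.
    have qS : q \in S by move: qS1; rewrite !inE => /andP[].
    rewrite -(dvdp_subr _ (_ : _ %| a0 *: pullback psi G)) ?D //.
    rewrite dvdpZr // pbG dvdp_mull // dvdp_exp2r //.
    by rewrite big_map (big_fsetD1 q) //= dvdp_mulr.
  apply/eqP/contraT => Pn; have := dvdp_leq Pn dP.
  have mW : W \is monic by exact: monic_prod_XsubC.
  rewrite size_Mmonic ?polyXsubC_eq0 ?monic_exp // size_XsubC.
  have := pullback_size psi_size Ph.
  have := size_exp W 2; rewrite size_prod_XsubC size_map /=.
  move=> h1 h2 h3; have {h3}: ((size (W ^+ 2)).+1 <= size (pullback psi P))%N := h3.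
  have s0 : (0 < size (W ^+ 2))%N by rewrite size_poly_gt0 monic_neq0 ?monic_exp.
  move: nd h1 h2 s0; rewrite -/x xE; move: (size _) (size _) (#|` _|) => s1 s2 s3.
  clear; lia.
have := D p1 p1S; rewrite P0 subr0 dvdpZr // pbG -/W expr2.
rewrite dvdp_mul2l ?polyXsubC_eq0 // dvdp_XsubCl.
by rewrite /root horner_exp expf_eq0 /= => /eqP W0; move: Wn; rewrite /root W0 eqxx.
Qed.
End CurvePoints.

Local Open Scope fset_scope.

Section CurveCohomology.
Variables (K : fieldType) (n : nat) (psi : 'I_n.+1 -> {poly K}).
Hypothesis psi_size : forall i, (size (psi i) <= n.+1)%N.
Hypothesis psi_unit : coef_mx psi \in unitmx.
Variables (S : {fset Pn K n}) (t : Pn K n -> K).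
Hypothesis S_t : forall p, p \in S -> val p = <[curve_pt psi (t p)]>%VS.
Local Notation R := {mpoly K[n.+1]}.
Local Notation lin := (lin psi).
Local Notation pt p := (curve_pt psi (t p)).
Local Notation y := (lin 1).

(** At a point [p] with ['X_i != 0], a jet of the fraction [h / 'X_i ^+ k] is the jet
    of a form of degree [D.+1]: write the jet of [h] as that of a power of ['X_i]
    times a linear form and cancel.  Forms with that jet at [p], singular at the
    other points of [S], exist because [S] is large enough to fill the first
    hyperplanes and small enough to fit in [D.+1] of them. *)
Lemma h_zero1_subset (A : {fset Pn K n}) D : (2 <= n)%N -> A `<=` S ->
  (n.*2 <= #|` S|)%N -> (#|` S|.-1.*2 < n * D.+1)%N -> h_zero 1 A D.+1.
Proof.
move=> n2 /fsubsetP AS nS SD; have n0 : (0 < n)%N by lia.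
have A_t p : p \in A -> val p = <[pt p]>%VS by move/AS; exact: S_t.
have [N [sep [seph sepp]]] := separators psi_size psi_unit A_t n0.
have yh : y \is 1.-homog by exact: lin_homog.
apply: (h_zero1_of_jets (pt := fun p => pt p) A_t yh (@y_pt _ _ _ psi_size psi_unit A t) seph sepp n2).
move=> p i k h /AS pS vi hh; set v := pt p in vi *.
pose y' : R := (v 0 i)^-1 *: 'X_i.
have y'h : y' \is 1.-homog by apply/dhomogZ/homogX1.
have y'v : mevalv y' v = 1 by rewrite mevalvZ mevalvX mulVf.
have [L [Lh _ LE]] := jet_linear y'h y'v (hh : h \is (D + k).+1.-homog).
pose h0 : R := (v 0 i) ^- k *: (y' ^+ D * L).
have h0h : h0 \is D.+1.-homog.
  by apply: dhomogZ; have := dhomogM (linear_form_exp y'h D) Lh; rewrite addn1.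
have Sp : #|` S `\ p| = #|` S|.-1 by rewrite (cardfsD1 p S) pS.
have [||||P [Ph Pq Pp]] := prescribed_jet psi_size psi_unit (ts := [seq t q | q <- S `\ p]) (t0 := t p) n0 _ _ _ _ h0h.
- rewrite map_inj_in_uniq ?fset_uniq // => q1 q2; rewrite !inE => /andP[_ h1] /andP[_ h2].
  exact: (param_inj S_t).
- apply/mapP => -[q]; rewrite !inE => /andP[qp qS] E.
  by case/eqP: qp; apply: (param_inj S_t).
- by rewrite size_map Sp; lia.
- by rewrite size_map Sp.
exists P; split=> // [q /AS qS qp|].
  by apply/Pq/map_f; rewrite !inE qp.
have -> : h - 'X_i ^+ k * P = h - y' ^+ (D + k) * L - 'X_i ^+ k * (P - h0).
  rewrite /h0 mulrBr.
  have -> : 'X_i ^+ k * (v 0 i ^- k *: (y' ^+ D * L)) = y' ^+ (D + k) * L.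
    have y'k : y' ^+ k = v 0 i ^- k *: 'X_i ^+ k by rewrite exprZn exprVn.
    rewrite exprD y'k -!mul_mpolyC; ring.
  by ring.
by apply: dvanB => //; exact: dvanMl.
Qed.

Lemma lin_power_pt j a : (j <= n)%N -> mevalv (lin 'X^j) (curve_pt psi a) = a ^+ j.
Proof. by move=> jn; rewrite lin_pt ?size_polyXn // hornerXn. Qed.

(** The first 2x2 minor of the Hankel matrix of the curve vanishes on it, and its
    square lies in [I_S ^ 2]. *)
Lemma h_pos0_quadric d : (2 <= n)%N -> (4 <= d)%N -> h_pos 0 S d.
Proof.
move=> n2 d4; pose Q : R := lin 'X^0 * lin 'X^2 - lin 'X^1 ^+ 2.
have Qh : Q \is 2.-homog.
  apply: rpredB; first by apply: (@dhomogM _ _ _ 1 _ 1); exact: lin_homog.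
  by apply: (@dhomogMn _ _ _ 1); exact: lin_homog.
have QS : vanishing_ideal S Q.
  apply: (vanishing_ideal_form (pt := fun p => pt p) S_t Qh) => p _.
  by rewrite mevalvB mevalvM mevalv_exp !lin_power_pt //; try lia; ring.
have Q0 : Q != 0.
  have [w hw] := lin_dual psi_unit (Ordinal (leqW n2 : (1 < n.+1)%N)).
  apply: contraTneq (oner_neq0 K) => Q0; rewrite negbK -oppr_eq0; apply/eqP.
  have := congr1 (fun f : R => mevalv f w) Q0.
  rewrite /= mevalvB mevalvM mevalv_exp !hw !coefXn /= => H.
  by transitivity (0 * 0 - 1 ^+ 2 : K); [ring | rewrite H /mevalv meval0].
have y0 : y != 0.
  apply: contraTneq (oner_neq0 K) => y0.
  have := lin_power_pt 0 (leq0n n); rewrite !expr0 y0 /mevalv meval0 => <-.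
  by rewrite eqxx.
apply: (@h_pos0_of_form _ _ _ _ (y ^+ (d - 4) * (Q * Q))).
- by rewrite !mulf_neq0 // expf_neq0.
- rewrite -[X in X.-homog](subnK d4); apply: dhomogM; last exact: (@dhomogM _ _ _ 2 _ 2).
  by apply: linear_form_exp; exact: lin_homog.
by move=> i; exists 0%N; do 2!apply: double_idealMl; exact: double_ideal_mul.
Qed.

(** The 3x3 Hankel determinant [f] of the coordinates of index 0 to 4: by
    Sylvester's identity its product with the coordinate of index 0, which is 1
    on the chosen points, is the determinant of the 2x2 minors containing that
    coordinate, each of which vanishes on the curve.  So [f] is singular along
    [S]. *)
Lemma h_pos0_cubic : (4 <= n)%N -> h_pos 0 S 3.
Proof.
move=> n4; have n0 : (0 < n)%N by lia.
have [N [sep [seph sepp]]] := separators psi_size psi_unit S_t n0.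
have yh : y \is 1.-homog by exact: lin_homog.
have y_S := @y_pt _ _ _ psi_size psi_unit S t.
pose Y j : R := lin 'X^j.
have Yh j : Y j \is 1.-homog by exact: lin_homog.
have Yp j a : (j <= 4)%N -> mevalv (Y j) (curve_pt psi a) = a ^+ j.
  by move=> j4; apply: lin_power_pt; lia.
pose f : R := Y 0%N * Y 2%N * Y 4%N + 2%:R * (Y 1%N * Y 2%N * Y 3%N)
   - Y 2%N * Y 2%N * Y 2%N - Y 0%N * Y 3%N * Y 3%N - Y 1%N * Y 1%N * Y 4%N.
have Y3 i j k : Y i * Y j * Y k \is 3.-homog.
  by apply: (@dhomogM _ _ _ 2 _ 1) => //; apply: (@dhomogM _ _ _ 1 _ 1).
have fh : f \is 3.-homog.
  do 3![apply: rpredB => //]; apply: rpredD => //.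
  by rewrite mulr_natl; apply: rpredMn.
have f0 : f != 0.
  have [w hw] := lin_dual psi_unit (Ordinal (leqW (ltnW n4) : (2 < n.+1)%N)).
  apply: contraTneq (oner_neq0 K) => f0; rewrite negbK -oppr_eq0; apply/eqP.
  have := congr1 (fun f : R => mevalv f w) f0.
  rewrite /= !(mevalvB, mevalvD, mevalvM) !hw !coefXn /= => H.
  transitivity (0 : K); last by [].
  rewrite -[RHS](meval0 (fun i => w 0 i)) -[RHS]H; ring.
have fS p : p \in S -> dvan (pt p) f.
  move=> pS; apply: (@dvan_cancel _ _ _ y); first by rewrite y_S // oner_neq0.
  have -> : y * f = (Y 0%N * Y 2%N - Y 1%N * Y 1%N) * (Y 0%N * Y 4%N - Y 2%N * Y 2%N)
     - (Y 0%N * Y 3%N - Y 1%N * Y 2%N) * (Y 0%N * Y 3%N - Y 1%N * Y 2%N).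
    have -> : y = Y 0%N by rewrite /Y expr0.
    by rewrite /f; ring.
  by apply: dvanB; apply: dvan_mul; rewrite mevalvB !mevalvM !Yp //; ring.
apply: (h_pos0_of_form f0 fh) => i; exists (N + N)%N.
exact: (double_ideal_local S_t yh y_S seph sepp fh fS).
Qed.
End CurveCohomology.

Theorem theorem4p2 (K : closedFieldType) (charK0 : [pchar K] =i pred0)
  (n d : nat) (hn : (2 <= n)%N) (hd : (3 <= d)%N) (hnd : (n, d) <> (2%N, 3%N))
  (C : Pn K n -> Prop) (hC : rational_normal_curve C)
  (x : nat) (S : {fset Pn K n}) (hSC : forall p, p \in S -> C p)
  (hx : #|` S| = x) :
  [/\ (3 <= n)%N -> (4 <= d)%N -> (1 + uphalf (n * d) <= x)%N ->
        terracini d x S,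
      (4 <= n)%N -> d = 3%N -> x = (1 + uphalf (n * d))%N ->
        terracini d x S &
      (2 <= n)%N -> (4 <= d)%N -> x = (1 + uphalf (n * d))%N ->
        min_terracini d x S].
Proof.
have [psi [t [psi_size psi_unit S_t]]] := curve_parametrization hC hSC.
have n0 : (0 < n)%N by apply: leq_trans hn.
have nd3 : (n * 3 <= n * d)%N by rewrite leq_mul2l hd orbT.
have terra : (1 + uphalf (n * d) <= x)%N -> h_pos 0 S d -> terracini d x S.
  move=> xd h0; split=> //.
    by apply: (h_pos1_many_points psi_size psi_unit S_t n0); rewrite hx; lia.
  by apply: (curve_points_span psi_size psi_unit S_t); rewrite hx; lia.
have quadric : (4 <= d)%N -> h_pos 0 S d.
  by move=> d4; apply: (h_pos0_quadric psi_size psi_unit S_t).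
split=> [n3 d4 xd|n4 d3 xd|_ d4 xd].
- by apply: terra => //; exact: quadric.
- by apply: terra; rewrite ?xd // d3; apply: (h_pos0_cubic psi_size psi_unit S_t).
split; first by apply: terra; rewrite ?xd //; exact: quadric.
move=> A /andP[/fsubsetP AS /fsubsetPn[s sS sA]].
have B_t p : p \in S `\ s -> val p = <[curve_pt psi (t p)]>%VS.
  by rewrite !inE => /andP[_]; exact: S_t.
have cB : #|` S `\ s| = uphalf (n * d).
  by move: hx; rewrite (cardfsD1 s S) sS xd => -[].
have nd4 : (n * 4 <= n * d)%N by rewrite leq_mul2l d4 orbT.
have Ed : d = d.-1.+1 by rewrite prednK // (leq_trans _ d4).
rewrite Ed; apply: (h_zero1_subset psi_size psi_unit B_t hn).
- by apply/fsubsetP => p pA; rewrite !inE AS // andbT; apply: contraNneq sA => <-.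
- by rewrite cB; lia.
- by rewrite -Ed cB; lia.
Qed.
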